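(* Let $I_j$ ($j\ge 0$) be the coefficients of the asymptotic series $I(n)\sim\sum_{j=0}^\infty \frac{I_j}{n^j}$, $n\to\infty$, of $I(n)=\int_0^1[x^n+(1-x)^n]^{1/n}\,dx$. For every integer $p\ge 2$, \[ I_p=\frac{(-1)^p}{2}\sum_{k=1}^{p-1}(-1)^k\,\zeta(k+1,\{1\}_{p-k-1})\sum_{j=0}^{k-1}\binom{k-1}{j}a_{\lfloor \frac{p-1-j}{2}\rfloor}. \]
   Context: The asymptotic series means that for every $N\ge 0$, $I(n)=\sum_{j=0}^N I_j n^{-j}+O(n^{-N-1})$ as $n\to\infty$; such a series exists and the coefficients $I_j$ are uniquely determined. $\{1\}_m$ denotes $1$ repeated $m$ times. The multiple zeta value is $\zeta(i_1,\dots,i_k)=\sum_{n_1>\cdots>n_k\ge 1}\frac{1}{n_1^{i_1}\cdots n_k^{i_k}}$ for positive integers $i_1,\dots,i_k$ with $i_1>1$. For integers $n\ge0$, $a_n=\frac12E_{2n+1}(0)=\frac{(1-2^{2n+2})B_{2n+2}}{2n+2}$, where $E_n(x)$ are the Euler polynomials, $\frac{2e^{tx}}{1+e^t}=\sum_{j\ge0}E_j(x)\frac{t^j}{j!}$, and $B_n$ are the Bernoulli numbers. *)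

(* Defs.v *)
From mathcomp Require Export all_boot all_order all_algebra.
From mathcomp Require Export all_classical all_reals all_analysis.

Set Implicit Arguments.
Unset Strict Implicit.
Unset Printing Implicit Defensive.

Export Order.TTheory GRing.Theory Num.Theory.
Export numFieldNormedType.Exports.

Local Open Scope classical_set_scope.
Local Open Scope ring_scope.

Section Defs.
Context {R : realType}.

Definition curveI (n : nat) : R :=
  \int[lebesgue_measure]_(x in `[0, 1]) ((x ^+ n + (1 - x) ^+ n) `^ n%:R^-1).

(* As n --> oo along the natural numbers.  The value at n = 0, where
   0^-1 = 0, is irrelevant. *)
Definition asymptotic_series (f c : nat -> R) : Prop :=
  forall N : nat,
    (fun n : nat => f n - \sum_(0 <= j < N.+1) c j / n%:R ^+ j)
    =O_\oo (fun n : nat => n%:R ^- N.+1 : R).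

(* For s = [:: i_1; ...; i_k], the sum over all n_1 > ... > n_k >= 1 of
   1 / (n_1 ^ i_1 * ... * n_k ^ i_k).  The terms are nonnegative, so the order
   of summation is irrelevant; [fine] only discards information when the sum
   diverges, which does not happen for positive i_1, ..., i_k with i_1 > 1. *)
Definition mzv (s : seq nat) : R :=
  fine (\esum_(n in [set n : (size s).-tuple nat
                         | sorted gtn n /\ all (fun m => 1 <= m)%N n])
          (\prod_(l < size s) ((tnth n l)%:R ^+ nth 0%N s l)^-1)%:E).

(* E_j(x) is j! times the coefficient of t^j in the Taylor expansion at t = 0
   of 2 e^(t x) / (1 + e^t), that is, the j-th derivative in t at 0. *)
Definition euler_poly (j : nat) (x : R) : R :=
  derive1n j (fun t : R => 2 * expR (t * x) / (1 + expR t)) 0.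

Definition euler_a (n : nat) : R := 2^-1 * euler_poly n.*2.+1 0.

End Defs.

(* Main.v *)
From HB Require Import structures.
Require Import Defs.
From mathcomp Require Import ring lra measurable_realfun.

(** Why the formula holds.

    Let K(a, b) = e^(2a+2b) / (e^a + e^b)^3 and let D be the set of the
    (a, b) with a, b > 0 and e^-a + e^-b >= 1.  For h = 1/n,
      I(n) = 3/4 + h^2 * (integral over D of K(h a, h b)).
    Indeed I(n) - 3/4 is the area between the graphs of max(x, 1 - x) and of
    (x^n + (1-x)^n)^(1/n), and (a, b) parametrizes this area through
    b - a = n ln (x / (1 - x)), the remaining variable measuring the height.
    The region D no longer depends on n, so the asymptotic series is the
    termwise integral of the Taylor series of K at the origin, and I_p is the
    integral over D of the part of degree p - 2 of K.

    Integrals of monomials over D are multiple zeta values: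
      integral of a^i b^j = i! j! zeta(i + 2, {1}_j).
    Integrating in b first gives (- ln (1 - e^-a))^(j+1) / (j + 1); the powers
    of this logarithm expand in powers of e^-a with multiple harmonic sums as
    coefficients, and what is left is a Gamma integral ([logpow_series],
    [mzvE], [moment_mzv]).

    The Taylor coefficients of K are computed umbrally.  With s the logistic
    function and g = s^2 (1 - s), one has K(h a, h b) = e^(h a) g(h (b - a)).
    If G^i stands for the i-th derivative of g at 0, the part of degree N of K
    is (a + (b - a) G)^N / N! = (b G + a (1 - G))^N / N!, and the binomial
    theorem gives G^(N-j) (1 - G)^j as coefficient of a^j b^(N-j) / (j! (N-j)!)
    ([ray_coef_expand]).  Since 2 g = s' - s'' and s - 1/2 is odd, G^i is, up
    to sign, half of the number a_m with m = floor((i + 1) / 2)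
    ([kernel_coef_euler]); this produces the inner sum of the theorem.

    K and D are symmetric in a and b, so it is enough to integrate over the
    half a <= b of D and to double.  There K and its derivatives are bounded,
    because a <= ln 2, which controls the Taylor remainder
    ([ray_kernel_taylor], [half_kernel_expansion]).  The half is described in
    the coordinates (u, a) with u = b - a, which suit the substitution
    x = s(u / n) in I(n) ([curveI_half_kernel]).  Finally, a function has at
    most one asymptotic series ([inv_poly_bigO_eq0]). *)

Set Implicit Arguments.
Unset Strict Implicit.
Unset Printing Implicit Defensive.

Local Open Scope classical_set_scope.
Local Open Scope ring_scope.

(** * Umbral evaluation of polynomials *)

Section Umbral.
Context {R : realType}.

(** The linear map that sends the power 'X^i to g i. *)
Definition umbral (V : lmodType R) (g : nat -> V) (p : {poly R}) : V :=
  \sum_(i < size p) p`_i *: g i.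

Lemma umbral_widened (V : lmodType R) (g : nat -> V) (p : {poly R}) n :
  (size p <= n)%N -> umbral g p = \sum_(i < n) p`_i *: g i.
Proof.
move=> pn; rewrite /umbral (big_ord_widen n (fun i => p`_i *: g i)) //.
rewrite big_mkcond /=; apply: eq_bigr => i _; case: ifPn => //.
by rewrite -leqNgt => /(nth_default 0) ->; rewrite scale0r.
Qed.

Lemma umbral_is_linear (V : lmodType R) (g : nat -> V) : linear (umbral g).
Proof.
move=> c p q; set n := maxn (size (c *: p + q)) (maxn (size p) (size q)).
rewrite !(@umbral_widened _ _ _ n) ?leq_max ?leqnn ?orbT //.
rewrite scaler_sumr -big_split /=; apply: eq_bigr => i _.
by rewrite coefD coefZ scalerDl scalerA.
Qed.

HB.instance Definition _ (V : lmodType R) (g : nat -> V) :=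
  GRing.isLinear.Build R {poly R} V _ (umbral g) (umbral_is_linear g).

Lemma umbralXn (V : lmodType R) (g : nat -> V) n : umbral g 'X^n = g n.
Proof.
rewrite /umbral size_polyXn big_ord_recr /= coefXn eqxx scale1r big1 ?add0r //.
by move=> i _; rewrite coefXn ltn_eqF // scale0r.
Qed.

Lemma umbral1 (V : lmodType R) (g : nat -> V) : umbral g 1 = g 0.
Proof. by rewrite -(umbralXn g 0) expr0. Qed.

Lemma umbral_map (V W : lmodType R) (f : {linear V -> W}) (g : nat -> V) p :
  f (umbral g p) = umbral (f \o g) p.
Proof. by rewrite linear_sum; apply: eq_bigr => i _; rewrite linearZ. Qed.

(** When g i is the i-th iterate of f at x, multiplying by 'X amounts to
    applying f: umbral evaluation turns polynomials into operators. *)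
Lemma umbral_mulX (V : lmodType R) (f : {linear V -> V}) (x : V) p :
  umbral (fun i => iter i f x) ('X * p) = f (umbral (fun i => iter i f x) p).
Proof.
rewrite umbral_map (@umbral_widened _ _ _ (size p).+1); last first.
  by rewrite (leq_trans (size_polyMleq _ _))// size_polyX.
rewrite big_ord_recl coefXM /= scale0r add0r; apply: eq_bigr => i _.
by rewrite coefXM.
Qed.

(** This lets iterates of an operator a + b f be expanded by the binomial
    theorem in the commutative ring of polynomials. *)
Lemma umbral_exp (V : lmodType R) (f : {linear V -> V}) (x : V) (a b : R) N :
  umbral (fun i => iter i f x) ((a%:P + b *: 'X) ^+ N) =
  iter N (fun y => a *: y + b *: f y) x.
Proof.
elim: N => [|N IH]; first by rewrite expr0 umbral1.
rewrite exprS mulrDl mul_polyC -scalerAl iterS -IH.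
by rewrite linearD !linearZ /= umbral_mulX.
Qed.

End Umbral.

(** * Taylor coefficients of the kernel along rays *)

Section Logistic.
Context {R : realType}.
Implicit Types (q w : {poly R}) (a b : R).

(** The logistic function s satisfies s' = s (1 - s), so this operator is
    differentiation of t |-> q(s(t)), seen on the polynomial q. *)
Definition logistic_deriv q : {poly R} := 'X * (1 - 'X) * q^`().

Lemma logistic_deriv_is_linear : linear logistic_deriv.
Proof.
by move=> c p q; rewrite /logistic_deriv derivD derivZ mulrDr scalerAr.
Qed.

HB.instance Definition _ :=
  GRing.isLinear.Build R {poly R} {poly R} _ logistic_deriv
    logistic_deriv_is_linear.

(** g = s^2 (1 - s), the restriction of the kernel to the line a = 0, as a
    polynomial in the logistic function s. *)
Definition kernel_poly : {poly R} := 'X ^+ 2 * (1 - 'X).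

(** Differentiation in h of e^(h a) q(s(h (b - a))), seen on q. *)
Definition ray_deriv a b q : {poly R} := a *: q + (b - a) *: logistic_deriv q.

(** The i-th derivative of g at 0, where the logistic function is 1/2.  The
    type is R as a module over itself, so that [umbral] applies. *)
Definition kernel_coef (i : nat) : R^o :=
  (iter i logistic_deriv kernel_poly).[2^-1].

(** The N-th derivative at h = 0 of the kernel at (h a, h b). *)
Definition ray_coef N a b : R := (iter N (ray_deriv a b) kernel_poly).[2^-1].

Definition poly_eval (x : R) (q : {poly R}) : R^o := q.[x].
Lemma poly_eval_is_linear x : linear (poly_eval x).
Proof. by move=> c p q; rewrite /poly_eval hornerD hornerZ. Qed.
HB.instance Definition _ x :=
  GRing.isLinear.Build R {poly R} R^o _ (poly_eval x) (poly_eval_is_linear x).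

(** Evaluation at x is linear, so it commutes with the umbral expansion of
    the iterates of [ray_deriv]. *)
Lemma iter_ray_deriv_horner N a b x : (iter N (ray_deriv a b) kernel_poly).[x] =
  umbral (fun i => (iter i logistic_deriv kernel_poly).[x] : R^o)
    ((a%:P + (b - a) *: 'X) ^+ N).
Proof.
by rewrite -(umbral_exp logistic_deriv kernel_poly) -[LHS]/(poly_eval x _)
  umbral_map.
Qed.

Lemma ray_coefE N a b :
  ray_coef N a b = umbral kernel_coef ((a%:P + (b - a) *: 'X) ^+ N).
Proof. exact: iter_ray_deriv_horner. Qed.

(** Rewriting a + (b - a) X as b X + a (1 - X) is what turns the Taylor
    coefficients into combinations of the monomials a^j b^(N-j). *)
Lemma ray_coef_expand N a b : ray_coef N a b =
  \sum_(j < N.+1) ('C(N, j)%:R * a ^+ j * b ^+ (N - j)) *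
     umbral kernel_coef ('X ^+ (N - j) * (1 - 'X) ^+ j).
Proof.
rewrite ray_coefE.
have -> : a%:P + (b - a) *: 'X = b *: 'X + a *: (1 - 'X) :> {poly R}.
  rewrite -!mul_polyC polyCB; ring.
rewrite exprDn raddf_sum; apply: eq_bigr => j _ /=.
rewrite !exprZn -scalerAl -scalerAr scalerA -scaler_nat scalerA linearZ /=.
by rewrite [b ^+ _ * _]mulrC mulrA.
Qed.

(** The symmetry of the kernel in a and b, at the level of polynomials: the
    exchange of a and b replaces s by 1 - s and multiplies the exponential
    factor by e^(h (b - a)) = s / (1 - s); differentiation preserves this
    relation. *)
Lemma ray_deriv_refl a b q w : (1 - 'X) * q = 'X * (w \Po (1 - 'X)) ->
  (1 - 'X) * ray_deriv a b q = 'X * (ray_deriv b a w \Po (1 - 'X)).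
Proof.
set U := w \Po (1 - 'X) => E.
have dU : U^`() = - (w^`() \Po (1 - 'X)).
  by rewrite /U deriv_comp derivB derivX derivC sub0r mulrN1.
have dE : - q + (1 - 'X) * q^`() = U + 'X * U^`().
  have := congr1 (@deriv R) E.
  by rewrite !derivM derivB derivX derivC sub0r mulN1r mul1r.
rewrite /ray_deriv /logistic_deriv comp_polyD !comp_polyZ !comp_polyM
  comp_polyB comp_polyX.
rewrite comp_polyC -/U.
have -> : w^`() \Po (1 - 'X) = - U^`() by rewrite dU opprK.
rewrite -!mul_polyC !polyCB.
have E2 : 'X * U^`() = - q + (1 - 'X) * q^`() - U by rewrite dE; ring.
transitivity (b%:P * ('X * U) - (a%:P - b%:P) *
  ((1 - 'X) * 'X * ('X * U^`()))); last by ring.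
have E3 : 'X * U = (1 - 'X) * q by rewrite E.
rewrite E3 E2.
transitivity (b%:P * ((1 - 'X) * q) - (a%:P - b%:P) *
  ((1 - 'X) * ('X * (- q + (1 - 'X) * q^`())) - (1 - 'X) * ('X * U)));
  last by ring.
rewrite E3; ring.
Qed.

(** At s = 1/2 the factors s and 1 - s of the previous relation cancel. *)
Lemma ray_coefC N a b : ray_coef N a b = ray_coef N b a.
Proof.
have : (1 - 'X) * iter N (ray_deriv a b) kernel_poly = 'X *
  (iter N (ray_deriv b a) kernel_poly \Po (1 - 'X)).
  elim: N => [|N IH]; last exact: ray_deriv_refl.
  rewrite /= /kernel_poly comp_polyM comp_polyB comp_Xn_poly comp_polyX
    comp_polyC; ring.
move=> /(congr1 (fun p => p.[2^-1])).
rewrite !hornerM horner_comp !hornerE.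
have -> : (1 - 2^-1 : R) = 2^-1 by lra.
by move=> /(mulfI _); apply; rewrite invr_neq0 // pnatr_eq0.
Qed.

Lemma logistic_derivX : logistic_deriv 'X = 'X * (1 - 'X).
Proof. by rewrite /logistic_deriv derivX mulr1. Qed.

(** 2 g = s' - s''. *)
Lemma kernel_polyE :
  kernel_poly =
  2^-1 *: (logistic_deriv 'X - logistic_deriv (logistic_deriv 'X)).
Proof.
rewrite logistic_derivX /logistic_deriv derivM derivX derivB derivX derivC
  /kernel_poly.
have -> : ('X * (1 - 'X) - 'X * (1 - 'X) * (1 * (1 - 'X) + 'X * (0 - 1)) :
  {poly R}) =
  2%:P * ('X ^+ 2 * (1 - 'X)).
  rewrite polyC_natr; ring.
by rewrite mul_polyC scalerA mulVf ?pnatr_eq0 // scale1r.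
Qed.

Lemma kernel_coefE i : kernel_coef i = 2^-1 *
  ((iter i.+1 logistic_deriv 'X).[2^-1] - (iter i.+2 logistic_deriv 'X).[2^-1]).
Proof.
have Z (c : R) p :
    iter i logistic_deriv (c *: p) = c *: iter i logistic_deriv p.
  by clear; elim: i => // i IH; rewrite /= IH linearZ.
have B p q : iter i logistic_deriv (p - q) =
    iter i logistic_deriv p - iter i logistic_deriv q.
  by clear; elim: i => // i IH; rewrite /= IH linearB.
by rewrite /kernel_coef kernel_polyE Z B -!iterSr hornerZ hornerD hornerN.
Qed.

(** The parity of the derivatives of s - 1/2, which is odd. *)
Lemma iter_logistic_deriv_refl i :
  iter i.+1 logistic_deriv 'X \Po (1 - 'X) =
  (-1) ^+ i * iter i.+1 logistic_deriv 'X.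
Proof.
elim: i => [|i IH].
  rewrite /= logistic_derivX comp_polyM comp_polyB comp_polyX comp_polyC; ring.
rewrite iterS /logistic_deriv comp_polyM; set q := iter _ _ _ in IH *.
have : (q \Po (1 - 'X))^`() = ((-1) ^+ i * q)^`() by rewrite IH.
rewrite deriv_comp derivB derivX derivC sub0r mulrN1.
rewrite -(rmorph_sign (@polyC R)) mul_polyC derivZ -mul_polyC rmorph_sign =>
  /eqP.
rewrite eqr_oppLR => /eqP ->.
rewrite comp_polyM comp_polyB comp_polyX comp_polyC exprS; ring.
Qed.

Lemma iter_logistic_deriv_half i :
  (iter i.*2.+2 logistic_deriv 'X).[2^-1] = 0 :> R.
Proof.
have := congr1 (fun p => p.[2^-1]) (iter_logistic_deriv_refl i.*2.+1).
rewrite horner_comp -(rmorph_sign (@polyC R)) mul_polyC hornerZ !hornerE.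
have -> : (1 - 2^-1 : R) = 2^-1 by lra.
rewrite exprS -signr_odd odd_double /=; set z := _.[_]; lra.
Qed.

End Logistic.

(** * Taylor expansion of the kernel with a uniform remainder *)

Section Taylor.
Context {R : realType}.
Implicit Types (a b x h : R).

Lemma is_derive_within_continuous (f df : R -> R) (i : interval R) :
  (forall x, x \in i -> is_derive x 1 f (df x)) ->
    {within [set` i], continuous f}.
Proof.
move=> d; apply: derivable_within_continuous => x xi.
by case: (d x xi).
Qed.

Lemma ge0_derive_le (f df : R -> R) a b : a <= b ->
  (forall x, a <= x <= b -> is_derive x 1 f (df x)) ->
  (forall x, a <= x <= b -> 0 <= df x) -> f a <= f b.
Proof.
move=> ab d d0.
have [||c cab E] := @MVT_segment R f df a b ab.
- by move=> x; rewrite in_itv /= => /andP[/ltW ? /ltW ?]; apply: d; apply/andP.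
- by apply: (@is_derive_within_continuous _ df) => x; rewrite in_itv /= => ?;
  apply: d.
by rewrite -subr_ge0 E mulr_ge0 ?subr_ge0 // d0.
Qed.

Lemma divf_fact_shift (i : nat) (c y : R) :
  c * y / i`!%:R = c / (i.+1%:R * i`!%:R) * i.+1%:R * y.
Proof.
have : i.+1%:R != 0 :> R by rewrite pnatr_eq0.
have : i`!%:R != 0 :> R by rewrite pnatr_eq0 -lt0n fact_gt0.
move: (i`!%:R : R) (i.+1%:R : R) => u v u0 v0.
by field; rewrite u0 v0.
Qed.

(** Induction on the order: the derivative of the remainder is a remainder of
    the previous order, and it is compared with the derivative of the bound. *)
Lemma taylor_bound N (f : nat -> R -> R) (M H : R) :
  (forall i x, is_derive x 1 (f i) (f i.+1 x)) ->
  (forall x, 0 <= x <= H -> `|f N x| <= M) ->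
  forall x, 0 <= x <= H ->
  `|f 0 x - \sum_(i < N) f i 0 * x ^+ i / i`!%:R| <= M * x ^+ N / N`!%:R.
Proof.
elim: N f => [|N IH] f df fM x xH.
  by rewrite big_ord0 subr0 expr0 mulr1 divr1; exact: fM.
have {}IH := IH (fun i => f i.+1) (fun i => df i.+1) fM.
pose p : {poly R} := \poly_(i < N.+1) (f i 0 / i`!%:R).
have pE y : \sum_(i < N.+1) f i 0 * y ^+ i / i`!%:R = p.[y].
  by rewrite horner_poly; apply: eq_bigr => i _; rewrite mulrAC.
have dpE y : \sum_(i < N) f i.+1 0 * y ^+ i / i`!%:R = p^`().[y].
  rewrite (@horner_coef_wide _ N); last first.
    by rewrite (leq_trans (size_poly _ _)) // -subn1 leq_subLR add1n size_poly.
  apply: eq_bigr => i _; rewrite coef_deriv coef_poly ltnS ltn_ord.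
  rewrite factS natrM -[_ *+ i.+1]mulr_natr; exact: divf_fact_shift.
have p0 : p.[0] = f 0 0.
  by rewrite horner_coef0 coef_poly /= fact0 divr1.
pose q : {poly R} := (M / N.+1`!%:R) *: 'X ^+ N.+1.
have qE y : q.[y] = M * y ^+ N.+1 / N.+1`!%:R.
  by rewrite !hornerE mulrAC.
have dqE y : q^`().[y] = M * y ^+ N / N`!%:R.
  rewrite derivZ derivXn hornerZ hornerMn hornerXn factS natrM
    -[(y ^+ N) *+ _]mulr_natr.
  rewrite [RHS]divf_fact_shift; ring.
have qz : q.[0] = 0 by rewrite qE exprS mul0r mulr0 mul0r.
have [x0 xH'] := andP xH.
rewrite pE -qE ler_norml; apply/andP; split.
- pose F y := q.[y] + (f 0 y - p.[y]).
  suff : F 0 <= F x by rewrite /F qz p0; lra.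
  apply: (@ge0_derive_le F (fun y => q^`().[y] + (f 1 y - p^`().[y]))) =>
    // y yx.
  have := IH y; rewrite dpE -dqE => /(_ _)/ler_normlP[|]; [by lra|by lra].
- pose F y := q.[y] - (f 0 y - p.[y]).
  suff : F 0 <= F x by rewrite /F qz p0; lra.
  apply: (@ge0_derive_le F (fun y => q^`().[y] - (f 1 y - p^`().[y]))) =>
    // y yx.
  have := IH y; rewrite dpE -dqE => /(_ _)/ler_normlP[|]; [by lra|by lra].
Qed.

Definition logistic (x : R) : R := (1 + expR (- x))^-1.

Lemma logistic_gt0 x : 0 < logistic x.
Proof. by rewrite invr_gt0 addr_gt0 // expR_gt0. Qed.

Lemma logistic_lt1 x : logistic x < 1.
Proof. by rewrite invf_lt1 ?addr_gt0 ?expR_gt0 // ltrDl expR_gt0. Qed.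

Lemma logistic0 : logistic 0 = 2^-1.
Proof. by rewrite /logistic oppr0 expR0. Qed.

Global Instance is_derive_logistic x :
  is_derive x 1 logistic (logistic x * (1 - logistic x)).
Proof.
have e0 : 1 + expR (- x) != 0 by rewrite gt_eqF // addr_gt0 // expR_gt0.
apply: is_derive_eq.
  apply: (@is_deriveV _ (fun y => 1 + expR (- y))) => //.
rewrite /logistic /GRing.scale /=; field; exact: e0.
Qed.

(** The value at (h a, h b) of the kernel built on q; for q = [kernel_poly]
    this is e^(2a+2b) / (e^a + e^b)^3 at that point. *)
Definition ray_kernel (q : {poly R}) a b h : R :=
  expR (h * a) * q.[logistic (h * (b - a))].

Lemma is_derive_ray_kernel q a b h :
  is_derive h 1 (ray_kernel q a b) (ray_kernel (ray_deriv a b q) a b h).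
Proof.
rewrite /ray_kernel; apply: is_derive_eq.
rewrite /ray_deriv /logistic_deriv !hornerE /GRing.scale /=; ring.
Qed.

Lemma poly_bounded01 (p : {poly R}) :
  exists C, forall x, 0 <= x <= 1 -> `|p.[x]| <= C.
Proof.
exists (\sum_(i < size p) `|p`_i|) => x /andP[x0 x1].
rewrite horner_coef (le_trans (ler_norm_sum _ _ _)) // ler_sum // => i _.
by rewrite normrM [`|x ^+ i|]ger0_norm ?exprn_ge0 // ler_piMr // exprn_ile1.
Qed.

(** For 0 <= a <= b the numbers a and b - a are nonnegative with sum b, so
    the binomial expansion of (a + (b - a) X)^N is bounded by b^N times the
    bounds of the derivatives of g. *)
Lemma iter_ray_deriv_bounded N : exists2 C, 0 <= C &
  forall a b x, 0 <= a <= b -> 0 <= x <= 1 ->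
  `|(iter N (ray_deriv a b) kernel_poly).[x]| <= C * b ^+ N.
Proof.
have [c cP] : exists c : nat -> R, forall i x, 0 <= x <= 1 ->
  `|(iter i logistic_deriv kernel_poly).[x]| <= c i.
  by have [c cP] := choice (fun i =>
    poly_bounded01 (iter i logistic_deriv kernel_poly)); exists c.
have c0 i : 0 <= c i by apply: le_trans (cP i 0 _);
  rewrite ?normr_ge0 ?lexx ?ler01.
exists (\sum_(i < N.+1) c i) => [|a b x /andP[a0 ab] x01];
  first exact: sumr_ge0.
rewrite iter_ray_deriv_horner exprDn linear_sum /=
  (le_trans (ler_norm_sum _ _ _)) //.
have -> : b ^+ N = \sum_(i < N.+1) 'C(N, i)%:R * a ^+ (N - i) * (b - a) ^+ i.
  rewrite -[b in LHS](subrKC a) exprDn; apply: eq_bigr => i _.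
  by rewrite -mulr_natl mulrA.
rewrite mulr_sumr; apply: ler_sum => i _.
rewrite -rmorphXn exprZn mul_polyC /= scalerA -scaler_nat scalerA mulrA.
rewrite linearZ /= umbralXn /GRing.scale /= normrM mulrC ler_pM //.
- rewrite (le_trans (cP i x x01)) // (bigD1 i) //= lerDl.
  by apply: sumr_ge0.
- by rewrite ger0_norm // !mulr_ge0 // ?exprn_ge0 // subr_ge0.
Qed.

(** The exponential factor stays below e because a <= 1.  The factor b^N is
    unbounded on the half region, but integrable there. *)
Lemma ray_kernel_taylor N : exists2 C, 0 <= C & forall a b h,
  0 <= a <= b -> a <= 1 -> 0 <= h <= 1 ->
  `|ray_kernel kernel_poly a b h -
    \sum_(i < N) ray_coef i a b * h ^+ i / i`!%:R| <= C * b ^+ N * h ^+ N.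
Proof.
have [C C0 CP] := iter_ray_deriv_bounded N.
exists (expR 1 * C / N`!%:R) => [|a b h ab a1 h01].
  by rewrite !mulr_ge0 ?expR_ge0.
have := @taylor_bound N (fun i =>
  ray_kernel (iter i (ray_deriv a b) kernel_poly) a b) (expR 1 * C * b ^+ N) 1
  (fun i x => is_derive_ray_kernel _ _ _ _) _ h h01.
under eq_bigr do rewrite /ray_kernel mul0r expR0 mul1r mul0r logistic0
  -/(ray_coef _ _ _).
move=> h'; have {h'} := h' _; set X := (X in _ <= X).
have -> : expR 1 * C / N`!%:R * b ^+ N * h ^+ N = X by rewrite /X; ring.
apply => x /andP[x0 x1].
rewrite /ray_kernel normrM -[leRHS]mulrA ler_pM //.
  have /andP[a0 _] := ab.
  by rewrite ger0_norm ?expR_ge0 // ler_expR mulr_ile1.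
by apply: CP => //; rewrite !ltW // ?logistic_lt1 ?logistic_gt0.
Qed.

End Taylor.

(** * Euler polynomials at 0 *)

Section EulerNumbers.
Context {R : realType}.

Lemma derive1n_poly_logistic (q : {poly R}) j :
  derive1n j (fun t : R => q.[logistic t]) =
  (fun t => (iter j logistic_deriv q).[logistic t]).
Proof.
elim: j => // j IH; rewrite /derive1n iterS -/(derive1n _ _) IH.
apply/funext => t; rewrite derive1E.
have : is_derive t 1 (fun t : R => (iter j logistic_deriv q).[logistic t])
  (iter j.+1 logistic_deriv q).[logistic t].
  rewrite iterS; move: (iter j logistic_deriv q) => p.
  by apply: is_derive_eq; rewrite /logistic_deriv !hornerE /GRing.scale /=;
    ring.
by case.
Qed.

(** 2 / (1 + e^t) = 2 - 2 s(t). *)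
Lemma euler_poly0 j :
  euler_poly j.+1 0 = - 2 * (iter j.+1 logistic_deriv 'X).[2^-1] :> R.
Proof.
rewrite /euler_poly.
have -> : (fun t : R => 2 * expR (t * 0) / (1 + expR t)) =
   (fun t => (2%:P - 2 *: 'X : {poly R}).[logistic t]).
  apply/funext => t; rewrite mulr0 expR0 mulr1 !hornerE /logistic expRN.
  have e0 := expR_gt0 t; have : 1 + expR t != 0 by rewrite gt_eqF // addr_gt0.
  have : expR t != 0 by rewrite gt_eqF.
  by move: (expR t) => v v0 v1; field; rewrite v0 addrC v1.
rewrite derive1n_poly_logistic logistic0 !iterSr.
have -> : logistic_deriv (2%:P - 2 *: 'X) = - 2 *: logistic_deriv 'X :>
  {poly R}.
  by rewrite /logistic_deriv derivB derivC derivZ derivX -!mul_polyC !polyCN;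
    ring.
have Z (k : R) p :
    iter j logistic_deriv (k *: p) = k *: iter j logistic_deriv p.
  by elim: j => // j IH; rewrite /= IH linearZ.
by rewrite Z hornerZ.
Qed.

(** By 2 g = s' - s'', the i-th derivative of g at 0 involves two
    consecutive derivatives of s, of which the one of even order vanishes. *)
Lemma kernel_coef_euler i :
  kernel_coef i = (-1) ^+ i.+1 / 2 * euler_a i.+1./2 :> R.
Proof.
rewrite kernel_coefE /euler_a.
rewrite -[i]odd_double_half; move: (i./2) => m; case: (odd i).
  rewrite add1n iter_logistic_deriv_half sub0r -[in euler_poly _ _]doubleS
    doubleK euler_poly0.
  by rewrite -signr_odd -doubleS odd_double /= expr0; field.
rewrite add0n iter_logistic_deriv_half subr0.
have -> : (m.*2.+1)./2 = m by rewrite -[m.*2.+1]add1n halfD odd_double add0n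
  doubleK.
by rewrite euler_poly0 -signr_odd /= odd_double /= expr1; field.
Qed.

(** G^(N-j) (1 - G)^j in umbral notation. *)
Definition mixed_coef N j : R :=
  umbral kernel_coef ('X ^+ (N - j) * (1 - 'X) ^+ j).

Lemma mixed_coefE N j : (j <= N)%N ->
  mixed_coef N j = (-1) ^+ (N + j).+1 / 2 *
    \sum_(l < j.+1) 'C(j, l)%:R * euler_a (N - l).+1./2 :> R.
Proof.
move=> jN; rewrite /mixed_coef [1 - _]addrC exprDn mulr_sumr raddf_sum
  mulr_sumr.
apply: eq_bigr => l _; rewrite expr1n mulr1 [(- 'X) ^+ _]exprNn.
have lj : (l <= j)%N by rewrite -ltnS.
have lN := leq_trans lj jN.
have -> : 'X^(N - j) * ((-1) ^+ (j - l) * 'X^(j - l) *+ 'C(j, l)) =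
  ((-1) ^+ (j - l) * 'C(j, l)%:R) *: 'X^(N - l) :> {poly R}.
  have -> : (N - l = (N - j) + (j - l))%N by rewrite addnBA // subnK.
  rewrite exprD -mul_polyC polyCM polyC_natr rmorph_sign -mulr_natr.
  by move: (_%:R) => ?; ring.
have S : (-1) ^+ (j - l) * (-1) ^+ (N - l).+1 = (-1) ^+ (N + j).+1 :> R.
  rewrite -exprD -signr_odd -[RHS]signr_odd; congr (_ ^+ _).
  by rewrite !oddD /= !oddB // oddD; case: (odd j); case: (odd l);
    case: (odd N).
rewrite /= linearZ /= umbralXn kernel_coef_euler -S.
rewrite /GRing.scale /=; ring.
Qed.

End EulerNumbers.

(** * Power series of the powers of - ln (1 - x) *)

Section LogPower.
Context {R : realType}.
Implicit Types (x y : R).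

(** The sum of 1 / (n_1 ... n_m) over n > n_1 > ... > n_m >= 1.  The index
    0 does no harm, since the inverse of 0 is 0; for m = 0 the value at
    n = 0 is 0, which makes [mharm_logpow_coef] hold without exception. *)
Fixpoint mharm (m n : nat) : R :=
  if m is m'.+1 then \sum_(0 <= i < n) mharm m' i / i%:R else (0 < n)%N%:R.

(** The coefficient of x^n in (- ln (1 - x))^m / m!. *)
Definition logpow_coef (m n : nat) : R :=
  if m is m'.+1 then mharm m' n / n%:R else (n == 0)%:R.

Lemma mharm_ge0 m n : 0 <= mharm m n.
Proof.
by elim: m n => [|m IH] n //=; apply: sumr_ge0 => i _; rewrite divr_ge0.
Qed.

Lemma logpow_coef_ge0 m n : 0 <= logpow_coef m n.
Proof. by case: m => //= m; rewrite divr_ge0 ?mharm_ge0. Qed.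

Lemma logpow_coef0 m : logpow_coef m.+1 0 = 0.
Proof. by rewrite /= invr0 mulr0. Qed.

(** Summing coefficients is multiplying the series by 1 / (1 - x), that is,
    taking the derivative of the next power of the logarithm. *)
Lemma mharm_logpow_coef m n : mharm m n = \sum_(i < n) logpow_coef m i.
Proof.
case: m => [|m]; last by rewrite /= big_mkord.
by case: n => [|n]; rewrite ?big_ord0 // big_ord_recl /= big1 ?addr0.
Qed.

Definition logpow_partial (m N : nat) x : R :=
  \sum_(i < N) logpow_coef m i * x ^+ i.

Definition logpow (m : nat) x : R := (- ln (1 - x)) ^+ m / m`!%:R.

Lemma is_derive_logpow m x : x < 1 ->
  is_derive x 1 (logpow m.+1) (logpow m x / (1 - x)).
Proof.
move=> x1.
have x1' : 1 - x != 0 by rewrite subr_eq0 gt_eqF.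
have d : is_derive x 1 (fun y : R => - ln (1 - y)) (1 - x)^-1.
  have ? : is_derive (1 - x) 1 (@ln R) (1 - x)^-1.
    by apply: is_derive1_ln; rewrite subr_gt0.
  apply: is_derive_eq.
  by rewrite /GRing.scale /=; ring.
have -> : logpow m.+1 = (m.+1`!%:R^-1 : R) *: ((fun y : R =>
  - ln (1 - y)) ^+ m.+1).
  by apply/funext => y; rewrite /logpow !fctE [LHS]mulrC.
apply: is_derive_eq.
rewrite /logpow /GRing.scale /= factS natrM.
have : m`!%:R != 0 :> R by rewrite pnatr_eq0 -lt0n fact_gt0.
have : m.+1%:R != 0 :> R by rewrite pnatr_eq0.
move: (m`!%:R : R) (m.+1%:R : R) => u v v0 u0.
by field; rewrite u0 v0 x1'.
Qed.

(** Up to one boundary term, (1 - x) times the derivative of a partial sum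
    of order m + 1 is a partial sum of order m. *)
Lemma logpow_partial_telescope m K x :
  (1 - x) * (\sum_(i < K) mharm m i.+1 * x ^+ i) =
  logpow_partial m K x - mharm m K * x ^+ K.
Proof.
elim: K => [|K IH].
  by rewrite /logpow_partial !big_ord0 mulr0 mharm_logpow_coef big_ord0 mul0r
    subr0.
rewrite /logpow_partial !big_ord_recr /= mulrDr IH !mharm_logpow_coef
  !big_ord_recr /=  /logpow_partial exprS; ring.
Qed.

Lemma is_derive_logpow_partial m K x :
  is_derive x 1 (logpow_partial m.+1 K.+1) (\sum_(i < K) mharm m i.+1 * x ^+ i).
Proof.
pose p : {poly R} := \poly_(i < K.+1) logpow_coef m.+1 i.
have -> : logpow_partial m.+1 K.+1 = horner p by apply/funext => y;
  rewrite horner_poly.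
apply: is_derive_eq.
rewrite (@horner_coef_wide _ K); last first.
  by rewrite (leq_trans (size_poly _ _)) // -subn1 leq_subLR add1n size_poly.
apply: eq_bigr => i _; rewrite coef_deriv coef_poly ltnS ltn_ord; congr (_ * _).
by rewrite /logpow_coef -[_ *+ i.+1]mulr_natr divfK // pnatr_eq0.
Qed.

Definition logpow_rem m K x := logpow m x - logpow_partial m K x.

(** Both statements are proved together, by induction on the power: the
    derivative of a remainder is, up to the factor 1 / (1 - x), the
    previous remainder plus a nonnegative boundary term. *)
Lemma logpow_rem_mono m : (forall K x, 0 <= x < 1 -> 0 <= logpow_rem m K x) /\
  (forall K x y, 0 <= x -> x <= y -> y < 1 ->
    logpow_rem m K x <= logpow_rem m K y).
Proof.
elim: m => [|m [IH1 IH2]].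
  have E K x : logpow_rem 0 K x = (K == 0)%:R.
    rewrite /logpow_rem /logpow expr0 fact0 divr1 /logpow_partial.
    case: K => [|K]; first by rewrite big_ord0 subr0.
    by rewrite big_ord_recl /= big1 ?addr0 ?mulr1 ?subrr // => i _;
      rewrite mul0r.
  by split => [K x|K x y _ _ _]; rewrite !E.
have mono K x y : 0 <= x -> x <= y -> y < 1 ->
  logpow_rem m.+1 K x <= logpow_rem m.+1 K y.
  move=> x0 xy y1; case: K => [|K].
    rewrite /logpow_rem /logpow_partial !big_ord0 !subr0 /logpow.
    rewrite ler_pM2r ?invr_gt0 ?ltr0n ?fact_gt0 //.
    have x1 := le_lt_trans xy y1.
    apply: lerXn2r; rewrite ?nnegrE ?oppr_ge0 ?ln_le0 ?gerBl ?(le_trans x0) //.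
    by rewrite lerN2 ler_ln ?posrE ?subr_gt0 // lerD2l lerN2.
  apply: (@ge0_derive_le _ (logpow_rem m.+1 K.+1)
     (fun z => logpow m z / (1 - z) - \sum_(i < K) mharm m i.+1 * z ^+ i)) =>
       // z /andP[xz zy];
    have z1 := le_lt_trans zy y1; have z0 := le_trans x0 xz.
    have := is_derive_logpow m z1; have := is_derive_logpow_partial m K z =>
      d1 d2.
    exact: is_deriveB.
  have z1' : 0 < 1 - z by rewrite subr_gt0.
  rewrite subr_ge0 ler_pdivlMr // mulrC logpow_partial_telescope.
  have := IH1 K z; rewrite z0 z1 => /(_ isT); rewrite /logpow_rem.
  have : 0 <= mharm m K * z ^+ K by rewrite mulr_ge0 ?mharm_ge0 ?exprn_ge0.
  lra.
split => // K x /andP[x0 x1]; apply: le_trans (mono K 0 x _ _ _) => //.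
rewrite /logpow_rem /logpow subr0 ln1 oppr0 expr0n mul0r sub0r /logpow_partial
  oppr_ge0.
case: K => [|K]; first by rewrite big_ord0.
rewrite big_ord_recl logpow_coef0 mul0r add0r big1 // => i _.
by rewrite /= exprS mul0r mulr0.
Qed.

(** Comparison with the convergent series at a point y between x and 1. *)
Lemma mharm_geom_cvg0 m x : 0 <= x < 1 ->
  (fun K => mharm m K * x ^+ K) @ \oo --> (0 : R).
Proof.
move=> /andP[x0 x1].
pose y := (1 + x) / 2.
have y0 : 0 < y by rewrite /y; lra.
have y1 : 0 <= y < 1 by rewrite /y; lra.
have xy : `|x / y| < 1.
  have := ltW y0 => y0'; rewrite ger0_norm; last exact: divr_ge0.
  by rewrite ltr_pdivrMr // mul1r /y; lra.
have B K : mharm m K * y ^+ K <= logpow m y.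
  have [h _] := logpow_rem_mono m.
  apply: (@le_trans _ _ (logpow_partial m K y)); last by rewrite -subr_ge0;
    exact: h.
  rewrite mharm_logpow_coef mulr_suml; apply: ler_sum => i _.
  rewrite ler_wpM2l ?logpow_coef_ge0 //; apply: ler_wiXn2l;
    [by lra|by lra|exact: ltnW].
apply: (@squeeze_cvgr _ _ _ _ (fun=> 0) (fun K => logpow m y * (x / y) ^+ K)).
- near=> K; apply/andP; split; first by rewrite mulr_ge0 ?mharm_ge0 ?exprn_ge0.
  rewrite expr_div_n mulrA ler_pdivlMr ?exprn_gt0 // mulrAC.
  by rewrite ler_wpM2r ?exprn_ge0.
- exact: cvg_cst.
- by rewrite -[X in _ --> X](mulr0 (logpow m y)); apply: cvgMr; exact: cvg_expr.
Unshelve. all: by end_near. Qed.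

(** By the mean value theorem a remainder is at most x / (1 - x) times the
    previous remainder plus the boundary term, both taken at x because they
    are nondecreasing. *)
Lemma logpow_rem_cvg0 m x : 0 <= x < 1 ->
  (fun K => logpow_rem m K x) @ \oo --> (0 : R).
Proof.
move=> x01; have /andP[x0 x1] := x01.
elim: m => [|m IH].
  rewrite -cvg_shiftS /=; apply: cvg_near_cst; near=> K.
  rewrite /logpow_rem /logpow expr0 fact0 divr1 /logpow_partial big_ord_recl /=
    big1 ?addr0 ?mulr1 ?subrr //.
  by move=> i _; rewrite mul0r.
rewrite -cvg_shiftS /=.
have [r0 rm] := logpow_rem_mono m.
have [r0' _] := logpow_rem_mono m.+1.
apply: (@squeeze_cvgr _ _ _ _ (fun=> 0)
  (fun K => (logpow_rem m K x + mharm m K * x ^+ K) * ((1 - x)^-1 * x))).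
- near=> K; rewrite r0' //=.
  have [||c] := @MVT_segment R (logpow_rem m.+1 K.+1)
    (fun z => logpow m z / (1 - z) - \sum_(i < K) mharm m i.+1 * z ^+ i) 0 x x0.
  + move=> z; rewrite in_itv /= => /andP[z0 zx].
    have := is_derive_logpow m (lt_trans zx x1); have :=
      is_derive_logpow_partial m K z => d1 d2.
    exact: is_deriveB.
  + apply: (@is_derive_within_continuous _ _ (fun z =>
    logpow m z / (1 - z) - \sum_(i < K) mharm m i.+1 * z ^+ i)).
    move=> z; rewrite in_itv /= => /andP[z0 zx].
    have := is_derive_logpow m (le_lt_trans zx x1); have :=
      is_derive_logpow_partial m K z => d1 d2.
    exact: is_deriveB.
  rewrite in_itv /= => /andP[c0 cx].
  have -> : logpow_rem m.+1 K.+1 0 = 0.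
    rewrite /logpow_rem /logpow subr0 ln1 oppr0 expr0n mul0r sub0r
      /logpow_partial.
    rewrite big_ord_recl logpow_coef0 mul0r add0r big1 ?oppr0 // => i _.
    by rewrite /= exprS mul0r mulr0.
  rewrite !subr0 => ->; rewrite mulrA ler_wpM2r //.
  have c1 : c < 1 by exact: le_lt_trans cx x1.
  have c1' : 0 < 1 - c by rewrite subr_gt0.
  have x1' : 0 < 1 - x by rewrite subr_gt0.
  have -> : logpow m c / (1 - c) - \sum_(i < K) mharm m i.+1 * c ^+ i =
    (logpow_rem m K c + mharm m K * c ^+ K) / (1 - c).
    have := logpow_partial_telescope m K c; set S := \sum_(i < K) _ => E.
    have -> : logpow_rem m K c + mharm m K * c ^+ K = logpow m c - (1 - c) * S.
      by rewrite E /logpow_rem; ring.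
    by field; rewrite gt_eqF.
  apply: ler_pM.
  + by rewrite addr_ge0 ?mulr_ge0 ?mharm_ge0 ?exprn_ge0 // r0 // c0.
  + by rewrite invr_ge0 ltW.
  + apply: lerD; first exact: rm.
    by rewrite ler_wpM2l ?mharm_ge0 // lerXn2r.
  + by rewrite lef_pV2 // lerD2l lerN2.
- exact: cvg_cst.
- rewrite -[X in _ --> X](mul0r ((1 - x)^-1 * x)); apply: cvgMl.
  rewrite -[X in _ --> X](addr0 0); apply: cvgD => //.
  exact: mharm_geom_cvg0.
Unshelve. all: by end_near. Qed.

Lemma logpow_partial_cvg m x : 0 <= x < 1 ->
  (fun K => logpow_partial m K x) @ \oo --> logpow m x.
Proof.
move=> x01; have := logpow_rem_cvg0 m x01 => /(cvgB (cvg_cst (logpow m x))).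
rewrite subr0; apply: cvg_trans; apply: near_eq_cvg; near=> K.
by rewrite !fctE /logpow_rem subKr.
Unshelve. all: by end_near.
Qed.

Lemma logpow_series m x : 0 <= x < 1 ->
  (\sum_(n <oo) (logpow_coef m n * x ^+ n)%:E)%E = (logpow m x)%:E.
Proof.
move=> x01; apply/cvg_lim => //.
under eq_fun do rewrite sumEFin big_mkord.
by apply: cvg_EFin; [exact: nearW|exact: logpow_partial_cvg].
Qed.

End LogPower.

(** * Multiple zeta values as series of multiple harmonic sums *)

Section MZV.
Context {R : realType}.

Lemma esumZl (T : choiceType) (I : set T) (c : R) (a : T -> \bar R) :
  0 <= c -> (forall i, I i -> (0 <= a i)%E) ->
  (\esum_(i in I) (c%:E * a i) = c%:E * \esum_(i in I) a i)%E.
Proof.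
have le (d : R) (b : T -> \bar R) : 0 <= d -> (forall i, I i -> (0 <= b i)%E) ->
    (\esum_(i in I) (d%:E * b i) <= d%:E * \esum_(i in I) b i)%E.
  move=> d0 b0; apply: ge_ereal_sup => _ [X [finX XI] <-].
  rewrite fsbig_finite //= big_seq -ge0_sume_distrr; last first.
    by move=> i; rewrite in_fset_set // inE => /XI /b0.
  rewrite lee_wpmul2l ?lee_fin //.
  by apply: ereal_sup_ubound; exists X => //; rewrite fsbig_finite //= -big_seq.
rewrite le_eqVlt => /predU1P[<-|c0] a0.
  by rewrite mul0e esum1 // => i Ii; rewrite mul0e.
apply/eqP; rewrite eq_le (le _ _ (ltW c0)) //=.
rewrite -(@lee_pdivlMl _ _ _ _ c0).
have := le c^-1 (fun i => c%:E * a i)%E.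
rewrite invr_ge0 ltW // => /(_ isT) h; apply: le_trans (h _).
  apply: le_esum => i Ii.
  by rewrite muleA -EFinM mulVf ?gt_eqF // mul1e.
by move=> i Ii; rewrite mule_ge0 ?a0 // lee_fin ltW.
Qed.

Definition mzv_term (s : seq nat) (t : (size s).-tuple nat) : \bar R :=
  (\prod_(l < size s) ((tnth t l)%:R ^+ nth 0%N s l)^-1)%:E.

(** The index set of [mzv], with a condition P on all entries so that the
    tail of a tuple, bounded by its head, ranges over a set of this form. *)
Definition decreasing_tuples (P : set nat) k : set (k.-tuple nat) :=
  [set t | (sorted gtn t /\ all (leq 1) t) /\
           (forall x, x \in (t : seq nat) -> P x)].

Lemma mzv_term_ge0 s t : (0 <= mzv_term (s := s) t)%E.
Proof.
by rewrite lee_fin prodr_ge0 // => l _; rewrite invr_ge0 exprn_ge0.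
Qed.

Lemma gtn_trans : transitive gtn.
Proof.
by move=> x y z; rewrite /gtn /= => xy zx; apply: ltn_trans zx xy.
Qed.

(** Summation over the head first.  As P is closed downwards, it suffices to
    impose it on the head. *)
Lemma esum_decreasing_cons (P : set nat) (i : nat) (s : seq nat) :
  (forall m n, (m < n)%N -> P n -> P m) ->
  \esum_(t in @decreasing_tuples P (size s).+1) mzv_term (s := i :: s) t =
  \esum_(n in [set n | (1 <= n)%N /\ P n])
     (((n%:R ^+ i)^-1)%:E *
      \esum_(t in @decreasing_tuples [set m | (m < n)%N] (size s)) mzv_term
        t)%E.
Proof.
move=> Pd.
have E (n : nat) : (((n%:R ^+ i)^-1 : R)%:E *
      \esum_(t in @decreasing_tuples [set m | (m < n)%N] (size s)) mzv_term
        t)%E =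
   (\esum_(t in @decreasing_tuples [set m | (m < n)%N] (size s))
      mzv_term (s := i :: s) [tuple of n :: t])%E.
  rewrite -esumZl ?invr_ge0 ?exprn_ge0 // => [|t _]; last exact: mzv_term_ge0.
  apply: eq_esum => t _; rewrite /mzv_term -EFinM; congr EFin.
  rewrite big_ord_recl /=; congr (_ * _).
  by apply: eq_bigr => l _; rewrite tnthS.
under [RHS]eq_esum do rewrite E.
rewrite esum_esum => [|n t _ _]; last exact: mzv_term_ge0.
apply: (@reindex_esum R _ _
  ([set n | (1 <= n)%N /\ P n] `*`` (fun n =>
    @decreasing_tuples [set m | (m < n)%N] (size s)))
  (@decreasing_tuples P (size s).+1)
  (fun k : nat * (size s).-tuple nat =>
    [tuple of k.1 :: k.2]) (@mzv_term (i :: s))).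
split.
- move=> [n t] /= [[n1 Pn] [[st at1] tn]]; split; first split.
  + rewrite /= path_sortedE ?st ?andbT; last exact: gtn_trans.
    by apply/allP => x /tn.
  + by rewrite /= n1.
  + by move=> x; rewrite inE => /predU1P[-> //|/tn /Pd]; apply.
- move=> [n t] [n' t'] _ _ /= /(congr1 val) /= [-> E'].
  by congr pair; apply: val_inj.
- move=> t [[+ +] +]; case: (tupleP t) => n t' st at1 tP.
  exists (n, t') => //=; move: st at1.
  rewrite /= path_sortedE; last exact: gtn_trans.
  move=> /andP[/allP tn st] /andP[n1 at1].
  split; split => //=.
  by apply: tP; rewrite inE eqxx.
Qed.

Lemma esum_decreasing_nseq m n : (0 < n)%N ->
  \esum_(t in @decreasing_tuples [set x | (x < n)%N] (size (nseq m 1%N)))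
    mzv_term t =
  (mharm m n)%:E.
Proof.
elim: m n => [|m IH] n n0.
  rewrite /= n0 (_ : @decreasing_tuples _ 0 = [set [tuple]]).
    by rewrite esum_set1 ?mzv_term_ge0 // /mzv_term big_ord0.
  by apply/seteqP; split => t /=; [rewrite tuple0|move=> ->].
rewrite /= esum_decreasing_cons => [|x y xy yn]; last exact: ltn_trans xy yn.
rewrite (eq_esum (b := fun k : nat => ((k%:R^-1 : R) * mharm m k)%:E));
  last first.
  by move=> k [k1 _]; rewrite IH // -EFinM expr1.
rewrite (_ : [set k | _] = [set` index_iota 1 n]); last first.
  by apply/seteqP; split => k /=; rewrite mem_index_iota => /andP.
rewrite esum_fset; [|exact: finite_seq|]; last first.
  by move=> k _; rewrite lee_fin mulr_ge0 ?invr_ge0 ?mharm_ge0.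
transitivity (\sum_(k <- index_iota 1 n) ((k%:R^-1 : R) * mharm m k)%:E)%E.
  by apply/esym/fsbig_seq/iota_uniq.
rewrite sumEFin [in RHS]big_ltn //= invr0 mulr0 add0r.
by congr EFin; apply: eq_bigr => k _; rewrite mulrC.
Qed.

Lemma mzvE (k m : nat) :
  mzv (k.+1 :: nseq m 1%N) =
  fine (\sum_(n <oo) (logpow_coef m.+1 n / n%:R ^+ k)%:E) :> R.
Proof.
rewrite /mzv; congr fine.
transitivity (\esum_(t in @decreasing_tuples setT (size (nseq m 1%N)).+1)
   mzv_term (s := k.+1 :: nseq m 1%N) t).
  congr esum; apply/seteqP; split => t /=; last by case.
  by move=> tP; split.
rewrite esum_decreasing_cons // [LHS]esum_mkcond [RHS]nneseries_esumT;
  last first.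
  by move=> n; rewrite lee_fin divr_ge0 ?logpow_coef_ge0 ?exprn_ge0.
apply: eq_esum => -[|n] _; first by rewrite memNset /= ?invr0 ?mulr0 ?mul0r //
  => -[].
rewrite mem_set //= esum_decreasing_nseq // -EFinM; congr EFin.
by rewrite exprS invfM mulrC mulrA.
Qed.

End MZV.

(** * The integration region and its sections *)

Section Tonelli.
Context {R : realType}.
Implicit Types (a c d u x y : R).
Notation mu := (@lebesgue_measure R).
Notation plane := (measurableTypeR R * measurableTypeR R)%type.
Notation mu2 := (mu \x mu)%E.

Lemma tonelli_xsection (E : set plane) (f : plane -> R) :
  measurable E -> measurable_fun setT f -> (forall z, E z -> 0 <= f z) ->
  (\int[mu2]_(z in E) (f z)%:E =
   \int[mu]_x \int[mu]_(y in [set y | E (x, y)]) (f (x, y))%:E)%E.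
Proof.
move=> mE mf f0; rewrite integral_mkcond.
rewrite fubini_tonelli1; last 2 first.
- apply/(measurable_restrictT _ _).1 => //; apply: measurable_funTS.
  exact/measurable_EFinP.
- by move=> z; apply: erestrict_ge0 => w Ew; rewrite lee_fin f0.
apply: eq_integral => x _; rewrite /fubini_F [in RHS]integral_mkcond.
by apply: eq_integral => y _; rewrite /patch; congr (if _ then _ else _);
  apply/idP/idP; rewrite !inE.
Qed.

Lemma tonelli_ysection (E : set plane) (f : plane -> R) :
  measurable E -> measurable_fun setT f -> (forall z, E z -> 0 <= f z) ->
  (\int[mu2]_(z in E) (f z)%:E =
   \int[mu]_y \int[mu]_(x in [set x | E (x, y)]) (f (x, y))%:E)%E.
Proof.
move=> mE mf f0; rewrite integral_mkcond.
rewrite fubini_tonelli2; last 2 first.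
- apply/(measurable_restrictT _ _).1 => //; apply: measurable_funTS.
  exact/measurable_EFinP.
- by move=> z; apply: erestrict_ge0 => w Ew; rewrite lee_fin f0.
apply: eq_integral => y _; rewrite /fubini_G [in RHS]integral_mkcond.
by apply: eq_integral => x _; rewrite /patch; congr (if _ then _ else _);
  apply/idP/idP; rewrite !inE.
Qed.

Lemma integral_vanish_outside (D : set R) (f g : R -> \bar R) :
  (forall x, D x -> f x = g x) -> (forall x, ~ D x -> f x = 0%E) ->
  (\int[mu]_x f x = \int[mu]_(x in D) g x)%E.
Proof.
move=> fg f0; rewrite [RHS]integral_mkcond; apply: eq_integral => x _.
by rewrite patchE; case: ifPn => [/set_mem/fg//|/negP xD]; apply: f0 => Dx;
  apply: xD; apply: mem_set.
Qed.

Lemma measurable_set_ge0 (f : plane -> R) : measurable_fun setT f ->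
  measurable [set z | 0 <= f z].
Proof.
move=> mf; rewrite (_ : [set _ | _] = setT `&` f @^-1` `[0, +oo[).
  exact: mf.
by apply/seteqP; split => z /=; rewrite in_itv /= andbT // => -[].
Qed.

Lemma measurable_set_gt0 (f : plane -> R) : measurable_fun setT f ->
  measurable [set z | 0 < f z].
Proof.
move=> mf; rewrite (_ : [set _ | _] = setT `&` f @^-1` `]0, +oo[).
  exact: mf.
by apply/seteqP; split => z /=; rewrite in_itv /= andbT // => -[].
Qed.

(** For b = a + u, the inequality e^-a + e^-b >= 1 says a <= softplusN u. *)
Definition softplusN (u : R) : R := ln (1 + expR (- u)).
(** The height over x of the boundary curve e^-x + e^-y = 1. *)
Definition dual_height (x : R) : R := - ln (1 - expR (- x)).

(** The part b >= a of [region] in the coordinates (u, a) with b = a + u. *)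
Definition half_region : set plane :=
  [set z | (0 <= z.1 /\ 0 < z.2) /\ expR z.2 <= 1 + expR (- z.1)].

Definition region : set plane :=
  [set z | (0 < z.1 /\ 0 < z.2) /\ 1 <= expR (- z.1) + expR (- z.2)].

Lemma measurable_half_region : measurable half_region.
Proof.
rewrite (_ : half_region = ([set z | 0 <= z.1] `&` [set z | 0 < z.2]) `&`
   [set z | 0 <= 1 + expR (- z.1) - expR z.2]).
  apply: measurableI; first apply: measurableI.
  - exact: measurable_set_ge0.
  - exact: measurable_set_gt0.
  - apply: measurable_set_ge0; apply: measurable_funB;
    first apply: measurable_funD => //.
      apply: measurableT_comp; first exact: measurable_expR.
      by apply: measurableT_comp.
    by apply: measurableT_comp => //; exact: measurable_expR.
by apply/seteqP; split => z /=; rewrite /half_region /= subr_ge0.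
Qed.

Lemma measurable_region : measurable region.
Proof.
rewrite (_ : region = ([set z | 0 < z.1] `&` [set z | 0 < z.2]) `&`
   [set z | 0 <= expR (- z.1) + expR (- z.2) - 1]).
  apply: measurableI; first apply: measurableI.
  - exact: measurable_set_gt0.
  - exact: measurable_set_gt0.
  - apply: measurable_set_ge0; apply: measurable_funB => //;
    apply: measurable_funD => //.
      apply: measurableT_comp; first exact: measurable_expR.
      by apply: measurableT_comp.
    apply: measurableT_comp; first exact: measurable_expR.
    by apply: measurableT_comp.
by apply/seteqP; split => z /=; rewrite /region /= subr_ge0.
Qed.

Lemma half_region_xsection u : 0 <= u ->
  [set a | half_region (u, a)] = `]0, softplusN u]%classic.
Proof.
move=> u0; apply/seteqP; split => a;
  rewrite /half_region /= in_itv /= /softplusN.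
  move=> [[_ ->] h] /=; rewrite -ler_expR lnK // posrE.
  by rewrite addr_gt0 ?expR_gt0.
move=> /andP[a0 h]; split => //; rewrite -ler_expR lnK // in h.
by rewrite posrE addr_gt0 ?expR_gt0.
Qed.

Lemma onem_expRN_gt0 x : 0 < x -> 0 < 1 - expR (- x) :> R.
Proof. by move=> x0; rewrite subr_gt0 expR_lt1 oppr_lt0. Qed.

Lemma le_dual_height x y : 0 < x ->
  (y <= dual_height x) = (1 <= expR (- x) + expR (- y)).
Proof.
move=> x0; have h := onem_expRN_gt0 x0.
by rewrite /dual_height lerNr -ler_expR lnK ?posrE // lerBlDl.
Qed.

Lemma region_xsection x : 0 < x ->
  [set y | region (x, y)] = `]0, dual_height x]%classic.
Proof.
move=> x0; apply/seteqP; split => y;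
  rewrite /region /= in_itv /= le_dual_height //.
  by move=> [[_ ->] ->].
by move=> /andP[y0 h].
Qed.

Lemma half_region_ysection a : 0 < a ->
  [set u | half_region (u, a)] = `[0, dual_height a - a]%classic.
Proof.
move=> a0; have E u : (u <= dual_height a - a) = (expR a <= 1 + expR (- u)).
  rewrite lerBrDr le_dual_height // -(ler_pM2l (expR_gt0 a)) mulr1 mulrDr
    -!expRD.
  by rewrite subrr expR0 opprD addrCA subrr addr0.
apply/seteqP; split => u; rewrite /half_region /= in_itv /= E.
  by move=> [[-> _] ->].
by move=> /andP[-> ->].
Qed.

Lemma is_derive_continuous (f df : R -> R) :
  (forall x, is_derive x 1 f (df x)) -> continuous f.
Proof.
by move=> d x; apply/differentiable_continuous/derivable1_diffP; case: (d x).
Qed.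

Lemma FTC_smooth (f F : R -> R) c d : c <= d ->
  (forall x, is_derive x 1 F (f x)) -> continuous f ->
  (\int[mu]_(x in `[c, d]) (f x)%:E = (F d - F c)%:E)%E.
Proof.
rewrite le_eqVlt => /predU1P[<-|cd] dF cf.
  by rewrite set_itv1 integral_set1 subrr.
have cF := is_derive_continuous dF.
rewrite (@continuous_FTC2 R f F) // ?EFinB //.
- exact: continuous_subspaceT.
- split; first by move=> x _; case: (dF x).
  + by apply: cvg_at_right_filter; exact: cF.
  + by apply: cvg_at_left_filter; exact: cF.
- by move=> x _; rewrite derive1E; case: (dF x).
Qed.

Lemma integral_pow_itv (k s : R) (j : nat) c d : c <= d ->
  (\int[mu]_(u in `[c, d]) (k * (u + s) ^+ j)%:E =
   (k * ((d + s) ^+ j.+1 - (c + s) ^+ j.+1) / j.+1%:R)%:E)%E.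
Proof.
pose F u : R := k / j.+1%:R * (u + s) ^+ j.+1.
have dF u : is_derive u 1 F (k * (u + s) ^+ j).
  have -> : F = (k / j.+1%:R) *: ((fun u => u + s) ^+ j.+1).
    by apply/funext => v; rewrite /F !fctE.
  apply: is_derive_eq; rewrite /GRing.scale /= addr0 mulr1.
  have : j.+1%:R != 0 :> R by rewrite pnatr_eq0.
  by move: (j.+1%:R : R) => v v0; field.
move=> cd; rewrite (FTC_smooth cd dF).
- by rewrite /F; congr EFin; ring.
- have -> : (fun u => k * (u + s) ^+ j) = horner (k *: ('X + s%:P) ^+ j).
    by apply/funext => u; rewrite hornerZ horner_exp !hornerE.
  exact: continuous_horner.
Qed.

End Tonelli.

(** * Moments of the region *)

Section Moments.
Context {R : realType}.
Implicit Types (a c d u x y : R).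
Notation mu := (@lebesgue_measure R).
Notation plane := (measurableTypeR R * measurableTypeR R)%type.
Notation mu2 := (mu \x mu)%E.

(** a^i b^j in the coordinates (u, a). *)
Definition half_monomial (i j : nat) (z : plane) : R :=
  z.2 ^+ i * (z.1 + z.2) ^+ j.
Definition monomial (i j : nat) (z : plane) : R := z.1 ^+ i * z.2 ^+ j.

Lemma measurable_half_monomial i j : measurable_fun setT (half_monomial i j).
Proof.
apply: measurable_funM; first exact: measurable_funX.
by apply: measurable_funX; apply: measurable_funD.
Qed.

Lemma measurable_monomial i j : measurable_fun setT (monomial i j).
Proof. by apply: measurable_funM; exact: measurable_funX. Qed.

Lemma half_monomial_ge0 i j z : half_region z -> 0 <= half_monomial i j z.
Proof.
move=> [[z1 z2] _]; rewrite mulr_ge0 ?exprn_ge0 ?addr_ge0 //; exact: ltW.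
Qed.

Lemma monomial_ge0 i j z : region z -> 0 <= monomial i j z.
Proof. by move=> [[/ltW z1 /ltW z2] _]; rewrite mulr_ge0 ?exprn_ge0. Qed.

Definition half_moment i j : \bar R :=
  (\int[mu2]_(z in half_region) (half_monomial i j z)%:E)%E.
Definition moment i j : \bar R :=
  (\int[mu2]_(z in region) (monomial i j z)%:E)%E.

Lemma integral_pow_shift k c d j :
  (\int[mu]_(u in `[0%R, (d - c)%R]) (k * (u + c) ^+ j)%:E =
   \int[mu]_(y in `[c, d]) (k * y ^+ j)%:E)%E.
Proof.
have [cd|dc] := leP c d; last first.
  by rewrite !set_itv_ge ?integral_set0 // bnd_simp -ltNge // subr_lt0.
rewrite integral_pow_itv ?subr_ge0 // subrK add0r.
under [RHS]eq_integral do rewrite -[X in X ^+ j]addr0.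
by rewrite integral_pow_itv // !addr0.
Qed.

Definition region_le : set plane := region `&` [set z | 0 <= z.2 - z.1].
Definition region_gt : set plane := region `&` [set z | 0 < z.1 - z.2].

Lemma measurable_region_le : measurable region_le.
Proof.
apply: measurableI; first exact: measurable_region.
by apply: measurable_set_ge0; apply: measurable_funB.
Qed.

Lemma measurable_region_gt : measurable region_gt.
Proof.
apply: measurableI; first exact: measurable_region.
by apply: measurable_set_gt0; apply: measurable_funB.
Qed.

(** The shift y = a + u, performed inside each horizontal section. *)
Lemma half_momentE i j : half_moment i j =
  (\int[mu]_(x in `]0%R, +oo[)
     \int[mu]_(y in `[x, dual_height x]) (x ^+ i * y ^+ j)%:E)%E.
Proof.
rewrite /half_moment tonelli_ysection;
  [|exact: measurable_half_region|exact: measurable_half_monomial|exact: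
  half_monomial_ge0].
apply: integral_vanish_outside => x /=; rewrite in_itv /= andbT => x0.
  rewrite half_region_ysection // /half_monomial /= integral_pow_shift //.
rewrite (_ : [set _ | _] = set0) ?integral_set0 //.
by apply/seteqP; split => u //= [[_ /=]].
Qed.

Lemma moment_region_le i j :
  (\int[mu2]_(z in region_le) (monomial i j z)%:E)%E = half_moment i j.
Proof.
rewrite half_momentE tonelli_xsection;
  [|exact: measurable_region_le|exact: measurable_monomial|by move=>
  z [/monomial_ge0]].
apply: integral_vanish_outside => x /=; rewrite in_itv /= andbT => x0.
  rewrite (_ : [set _ | _] = `[x, dual_height x]%classic) //.
  apply/seteqP; split => y;
    rewrite /region_le /region /= in_itv /= le_dual_height // subr_ge0.
    by move=> [[[_ _] ->] ->].
  by move=> /andP[xy h]; split => //; split => //; split => //;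
    exact: lt_le_trans xy.
rewrite (_ : [set _ | _] = set0) ?integral_set0 //.
by apply/seteqP; split => u //= [[[]]].
Qed.

(** Where x > y the roles of x and y are exchanged: sections are taken in the
    other direction. *)
Lemma moment_region_gt i j :
  (\int[mu2]_(z in region_gt) (monomial i j z)%:E)%E = half_moment j i.
Proof.
rewrite half_momentE tonelli_ysection;
  [|exact: measurable_region_gt|exact: measurable_monomial|by move=>
  z [/monomial_ge0]].
apply: integral_vanish_outside => x /=; rewrite in_itv /= andbT => x0.
  rewrite (_ : [set _ | _] = `]x, dual_height x]%classic).
    rewrite integral_itv_obnd_cbnd; last first.
      apply/measurable_EFinP; by apply: measurable_funM => /=;
        [exact: measurable_funX|exact: measurable_cst].
    by apply: eq_integral => y _; rewrite /monomial /= mulrC.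
  apply/seteqP; split => y;
    rewrite /region_gt /region /= in_itv /= le_dual_height // subr_gt0 addrC.
    by move=> [[[_ _] ->] ->].
  by move=> /andP[xy h]; split => //; split => //; split => //;
    exact: lt_trans xy.
rewrite (_ : [set _ | _] = set0) ?integral_set0 //.
by apply/seteqP; split => u //= [[[]]].
Qed.

(** The region is cut into x <= y and x > y; the sections of the second part
    differ from those of the half region by an end point only. *)
Lemma momentE i j : moment i j = (half_moment i j + half_moment j i)%E.
Proof.
rewrite -moment_region_le -moment_region_gt -ge0_integral_setU.
- congr integral; apply/seteqP; split => z /=.
    by move=> Dz; have [h|h] := lerP z.1 z.2; [left|right]; split => //=;
      rewrite ?subr_ge0 ?subr_gt0.
  by move=> [] [].
- exact: measurable_region_le.
- exact: measurable_region_gt.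
- apply/measurable_EFinP. apply: measurable_funTS; exact: measurable_monomial.
- by move=> z [] [/(monomial_ge0 i j) h _]; rewrite lee_fin.
- apply/disj_setPS => z [] [_ /= h] [_ /=]; rewrite subr_gt0 ltNge.
  by rewrite subr_ge0 in h; rewrite h.
Qed.

(** The inner integral of y^j up to the boundary curve is a power of the
    logarithm - ln (1 - e^-x). *)
Lemma moment_logpow i j : moment i j =
  (\int[mu]_(x in `]0%R, +oo[)
     (j`!%:R * x ^+ i * logpow j.+1 (expR (- x)))%:E)%E.
Proof.
rewrite /moment tonelli_xsection;
  [|exact: measurable_region|exact: measurable_monomial|exact: monomial_ge0].
apply: integral_vanish_outside => x /=; rewrite in_itv /= andbT => x0.
  rewrite region_xsection // integral_itv_obnd_cbnd; last first.
    by apply/measurable_EFinP; apply: measurable_funM => /=;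
      [exact: measurable_cst|exact: measurable_funX].
  under eq_integral do rewrite /monomial /= -[X in X ^+ j]addr0.
  rewrite integral_pow_itv; last first.
    by rewrite le_dual_height // oppr0 expR0 lerDr expR_ge0.
  congr EFin; rewrite !addr0 expr0n subr0 /logpow /dual_height factS natrM.
  have : j`!%:R != 0 :> R by rewrite pnatr_eq0 -lt0n fact_gt0.
  have : j.+1%:R != 0 :> R by rewrite pnatr_eq0.
  move: (j`!%:R : R) (j.+1%:R : R) => v w v0 w0.
  by field; rewrite v0 w0.
rewrite (_ : [set _ | _] = set0) ?integral_set0 //.
by apply/seteqP; split => u //= [[]].
Qed.

End Moments.

(** * Moments are multiple zeta values *)

Section Gamma.
Context {R : realType}.
Implicit Types (a c d u x y r : R).
Notation mu := (@lebesgue_measure R).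
Notation plane := (measurableTypeR R * measurableTypeR R)%type.
Notation mu2 := (mu \x mu)%E.

Lemma pow_le_exp j x : 0 <= x -> x ^+ j / j`!%:R <= expR x.
Proof.
move=> x0; case: j => [|j].
  by rewrite expr0 fact0 divr1 -expR0 ler_expR.
by apply: le_trans (expR_ge1Dxn j x0); rewrite lerDr.
Qed.

Lemma cvg_pow_exp r j : 0 < r ->
  expR (- (r * x)) * x ^+ j @[x --> +oo] --> (0 : R).
Proof.
move=> r0.
apply: (@squeeze_cvgr _ _ _ _ (fun=> 0) (fun x =>
  (j.+1`!%:R / r ^+ j.+1) * x^-1)).
- near=> x.
  have x0 : 0 < x by near: x; apply: nbhs_pinfty_gt; rewrite num_real.
  rewrite mulr_ge0 ?expR_ge0 ?exprn_ge0 ?(ltW x0) //=.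
  have := pow_le_exp j.+1 (mulr_ge0 (ltW r0) (ltW x0)).
  have f0 : 0 < j.+1`!%:R :> R by rewrite ltr0n fact_gt0.
  rewrite ler_pdivrMr // exprMn => h.
  rewrite expRN ler_pdivlMr // -mulrA -exprSr ler_pdivlMr ?exprn_gt0 //.
  by rewrite -mulrA ler_pdivrMl ?expR_gt0 // mulrC.
- exact: cvg_cst.
- rewrite -[X in _ --> X](mulr0 (j.+1`!%:R / r ^+ j.+1)); apply: cvgMr.
  apply/gtr0_cvgV0; last exact: cvg_id.
  by apply: nbhs_pinfty_gt; rewrite num_real.
Unshelve. all: by end_near. Qed.

Lemma cvg_poly_exp r (p : {poly R}) : 0 < r ->
  expR (- (r * x)) * p.[x] @[x --> +oo] --> (0 : R).
Proof.
move=> r0.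
suff h j : expR (- (r * x)) * x ^+ j * p.[x] @[x --> +oo] --> (0 : R).
  by have := h 0; under eq_fun do rewrite expr0 mulr1.
elim/poly_ind: p j => [|p c IH] j.
  by under eq_fun do rewrite horner0 mulr0; exact: cvg_cst.
have -> : (fun x => expR (- (r * x)) * x ^+ j * (p * 'X + c%:P).[x]) =
  (fun x => expR (- (r * x)) * x ^+ j.+1 * p.[x] + c * (expR (- (r * x)) *
    x ^+ j)).
  by apply/funext => x; rewrite hornerMXaddC exprS; ring.
rewrite -[X in _ --> X]addr0; apply: cvgD; first exact: IH.
rewrite -[X in _ --> X](mulr0 c); apply: cvgMr; exact: cvg_pow_exp.
Qed.

(** The antiderivative is a multiple of e^(-r x) p(x), with p the truncated
    exponential series in r x: p' - r p is then a single monomial. *)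
Lemma integral_pow_expR r i : 0 < r ->
  (\int[mu]_(x in `]0%R, +oo[) (x ^+ i * expR (- (r * x)))%:E =
   (i`!%:R / r ^+ i.+1)%:E)%E.
Proof.
move=> r0.
pose p : {poly R} := \poly_(l < i.+1) (r ^+ l / l`!%:R).
pose k : R := - (i`!%:R / r ^+ i.+1).
pose f x : R := x ^+ i * expR (- (r * x)).
have f0 : i`!%:R != 0 :> R by rewrite pnatr_eq0 -lt0n fact_gt0.
have pE : p^`() - r *: p = - (r ^+ i.+1 / i`!%:R) *: 'X^i.
  apply/polyP => l; rewrite coefB coef_deriv !coefZ !coef_poly coefXn !ltnS.
  have [->|li] := eqVneq l i.
    by rewrite ltnn leqnn mul0rn sub0r mulr1 exprS mulrA.
  case: ltnP => [li'|il]; last first.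
    by rewrite leqNgt ltn_neqAle eq_sym li il /= mul0rn !mulr0 subr0.
  rewrite (ltnW li') mulr0 factS natrM exprS -[_ *+ l.+1]mulr_natr.
  have : l`!%:R != 0 :> R by rewrite pnatr_eq0 -lt0n fact_gt0.
  have : l.+1%:R != 0 :> R by rewrite pnatr_eq0.
  move: (l`!%:R : R) (l.+1%:R : R) => v w v0 w0.
  by field; rewrite v0 w0.
pose F x : R := k * (expR (- (r * x)) * p.[x]).
have dF x : is_derive x 1 F (f x).
  rewrite /F; apply: is_derive_eq.
  rewrite /GRing.scale /=.
  have := congr1 (fun q => q.[x]) pE; rewrite !hornerE => E.
  have -> : p^`().[x] = r * p.[x] - r ^+ i.+1 / i`!%:R * x ^+ i.
    by rewrite -mulNr -E addrC subrK.
  rewrite /k /f.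
  have : r ^+ i.+1 != 0 by rewrite expf_neq0 // gt_eqF.
  move: (r ^+ i.+1) (i`!%:R : R) f0 => v w w0 v0.
  rewrite -[LHS]/(- (w / v) * (expR (- (r * x)) * (r * p.[x] - v / w * x ^+ i) +
    p.[x] * expR (- (r * x)) * - r)).
  by field; rewrite v0 w0.
have cf : continuous f.
  move=> x; apply: cvgM; first exact: exprn_continuous.
  apply: continuous_comp; last exact: continuous_expR.
  by apply: cvgN; apply: cvgM; [exact: cvg_cst|exact: cvg_id].
have cF : continuous F := is_derive_continuous dF.
rewrite integral_itv_obnd_cbnd; last first.
  apply/measurable_EFinP; apply: measurable_funTS.
  exact: continuous_measurable_fun.
have -> : (i`!%:R / r ^+ i.+1)%:E = (0%:E - (F 0)%:E)%E.
  rewrite /F mulr0 oppr0 expR0 mul1r horner_coef0 coef_poly /= expr0 fact0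
    divr1.
  by rewrite mulr1 /k -EFinB opprK add0r.
apply: (@ge0_continuous_FTC2y R f F 0 0).
- by move=> x x0; rewrite mulr_ge0 ?exprn_ge0 ?expR_ge0.
- exact: continuous_subspaceT.
- rewrite -[X in _ --> X](mulr0 k); apply: cvgMr; exact: cvg_poly_exp.
- by move=> x _; case: (dF x).
- by apply: cvg_at_right_filter; exact: cF.
- by move=> x _; rewrite derive1E; case: (dF x).
Qed.

(** Monotone convergence and one Gamma integral for each n. *)
Lemma moment_series i j : moment i j =
  ((i`!%:R * j`!%:R)%:E *
   \sum_(n <oo) (logpow_coef j.+1 n / n%:R ^+ i.+1 : R)%:E)%E.
Proof.
rewrite moment_logpow.
transitivity (\int[mu]_(x in `]0%R, +oo[)
  (\sum_(n <oo) (j`!%:R * logpow_coef j.+1 n *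
    (x ^+ i * expR (- (n%:R * x))))%:E))%E.
  apply: eq_integral => x; rewrite inE /= in_itv /= andbT => x0.
  have x01 : 0 <= expR (- x) < 1 by rewrite expR_ge0 expR_lt1 oppr_lt0.
  rewrite EFinM -(logpow_series _ x01) -nneseriesZl; last first.
    by move=> n _; rewrite lee_fin mulr_ge0 ?logpow_coef_ge0 ?exprn_ge0 //
      expR_ge0.
  apply: eq_eseriesr => n _; rewrite -EFinM; congr EFin.
  by rewrite -expRM_natl mulrN mulrACA.
rewrite integral_nneseries //; last 2 first.
- move=> n; apply/measurable_EFinP; apply: measurable_funM => //.
  apply: measurable_funM; first exact: measurable_funX.
  apply: measurableT_comp; first exact: measurable_expR.
  by apply: measurableT_comp => //; apply: measurable_funM.
- move=> n x /=; rewrite in_itv /= andbT => /ltW x0.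
  rewrite lee_fin; apply: mulr_ge0; last by rewrite mulr_ge0 ?exprn_ge0
    ?expR_ge0.
  by apply: mulr_ge0 => //; exact: (logpow_coef_ge0 j.+1).
rewrite -nneseriesZl; last first.
  by move=> n _; rewrite lee_fin divr_ge0 ?logpow_coef_ge0 ?exprn_ge0.
apply: eq_eseriesr => -[|n] _.
  rewrite logpow_coef0 mulr0 mul0r mule0; apply: integral0_eq => x _;
    by rewrite mul0r.
under eq_integral do rewrite EFinM.
rewrite ge0_integralZl_EFin //; last 3 first.
- move=> x /=; rewrite in_itv /= andbT => /ltW x0.
  by rewrite lee_fin mulr_ge0 ?exprn_ge0 ?expR_ge0.
- apply/measurable_EFinP.
  apply: measurable_funM; first exact: measurable_funX.
  apply: measurableT_comp; first exact: measurable_expR.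
  by apply: measurableT_comp => //; apply: measurable_funM.
- by rewrite mulr_ge0 ?logpow_coef_ge0.
rewrite integral_pow_expR ?ltr0n // -!EFinM; congr EFin; ring.
Qed.

(** Taking [fine] commutes with multiplication by a positive real, also at
    infinity. *)
Lemma moment_mzv i j : fine (moment i j) =
  i`!%:R * j`!%:R * mzv (i.+2 :: nseq j 1%N) :> R.
Proof.
rewrite moment_series mzvE; set y := (\sum_(n <oo) _)%E.
have k0 : 0 < i`!%:R * j`!%:R :> R by rewrite mulr_gt0 // ltr0n fact_gt0.
case: y => [s| |] //; first by rewrite gt0_muley ?lte_fin //= mulr0.
by rewrite gt0_muleNy ?lte_fin //= mulr0.
Qed.

(** A set that contains [half_region], as ln (1 + t) <= t, and whose
    sections have an explicit length. *)
Definition half_majorant : set plane :=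
  [set z | (0 <= z.1 /\ 0 < z.2) /\ z.2 <= expR (- z.1)].

Lemma measurable_half_majorant : measurable half_majorant.
Proof.
rewrite (_ : half_majorant = ([set z | 0 <= z.1] `&` [set z | 0 < z.2]) `&`
   [set z | 0 <= expR (- z.1) - z.2]).
  apply: measurableI; first apply: measurableI.
  - exact: measurable_set_ge0.
  - exact: measurable_set_gt0.
  - apply: measurable_set_ge0; apply: measurable_funB => //.
      apply: measurableT_comp; first exact: measurable_expR.
      by apply: measurableT_comp.
by apply/seteqP; split => z /=; rewrite /half_majorant /= subr_ge0.
Qed.

Lemma half_region_sub : half_region `<=` half_majorant.
Proof.
move=> z [[z1 z2] h]; split => //.
by have := le_trans (expR_ge1Dx z.2) h; rewrite lerD2l.
Qed.

(** The monomial grows at most like e^(u/2) while the section over u has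
    length at most e^-u. *)
Lemma half_moment_lty i j : (half_moment i j < +oo :> \bar R)%E.
Proof.
(* (u + 1)^j = 2^j ((u + 1) / 2)^j <= 2^j j! e^((u + 1) / 2) *)
pose C : R := 2 ^+ j * j`!%:R * expR 2^-1.
have C0 : 0 <= C by rewrite !mulr_ge0 ?expR_ge0 ?exprn_ge0.
pose g (z : plane) : R := C * expR (z.1 / 2).
have mg : measurable_fun setT g.
  apply: measurable_funM => //; apply: measurableT_comp;
    first exact: measurable_expR.
  exact: measurable_funM.
have g0 z : 0 <= g z by rewrite mulr_ge0 ?expR_ge0.
apply: (@le_lt_trans _ _ (\int[mu2]_(z in half_majorant) (g z)%:E)%E).
  apply: (@le_trans _ _ (\int[mu2]_(z in half_region) (g z)%:E)%E).
    apply: ge0_le_integral.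
    - exact: measurable_half_region.
    - by move=> z /(half_monomial_ge0 i j); rewrite lee_fin.
    - by apply/measurable_EFinP/measurable_funTS;
      exact: measurable_half_monomial.
    - by apply/measurable_EFinP/measurable_funTS.
    move=> z Oz; have [[z1 z2] _] := Oz; have [_ z2'] := half_region_sub Oz.
    have z21 : z.2 <= 1 by apply: le_trans z2' _; rewrite expR_le1 oppr_le0.
    rewrite lee_fin /half_monomial /g.
    apply: (@le_trans _ _ ((z.1 + 1) ^+ j)).
      rewrite -[leRHS]mul1r ler_pM ?exprn_ge0 ?addr_ge0 ?(ltW z2) //.
        by rewrite exprn_ile1 // ltW.
      by rewrite lerXn2r ?nnegrE ?addr_ge0 ?(ltW z2) // lerD2l.
    have h : 0 <= (z.1 + 1) / 2 by rewrite divr_ge0 // addr_ge0.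
    have := pow_le_exp j h; rewrite ler_pdivrMr ?ltr0n ?fact_gt0 //.
    rewrite expr_div_n ler_pdivrMr ?exprn_gt0 // => /le_trans; apply.
    rewrite mulrDl mul1r expRD /C le_eqVlt; apply/orP; left; apply/eqP; ring.
  apply: ge0_subset_integral.
  - exact: measurable_half_region.
  - exact: measurable_half_majorant.
  - by apply/measurable_EFinP/measurable_funTS.
  - by move=> z _; rewrite lee_fin.
  - exact: half_region_sub.
rewrite tonelli_xsection //; last exact: measurable_half_majorant.
rewrite (@integral_vanish_outside _
  `[0, +oo[ _ (fun u => (C%:E * (u ^+ 0 * expR (- (2^-1 * u)))%:E)%E)).
- rewrite -integral_itv_obnd_cbnd; last first.
    apply: measurable_funeM; apply/measurable_EFinP.
    apply: measurable_funM => //.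
    apply: measurableT_comp; first exact: measurable_expR.
    by apply: measurableT_comp => //; apply: measurable_funM.
  rewrite ge0_integralZl_EFin //.
  + by rewrite integral_pow_expR ?invr_gt0 // -EFinM ltry.
  + by move=> x _; rewrite lee_fin mulr_ge0 ?expR_ge0.
  + apply/measurable_EFinP; apply: measurable_funM => //.
    apply: measurableT_comp; first exact: measurable_expR.
    by apply: measurableT_comp => //; apply: measurable_funM.
- move=> u /=; rewrite in_itv /= andbT => u0.
  rewrite (_ : [set _ | _] = `]0, expR (- u)]%classic); last first.
    apply/seteqP; split => y; rewrite /half_majorant /= in_itv /=.
      by move=> [[_ ->] ->].
    by move=> /andP[y0 y1].
  rewrite /g /= integral_cst //= lebesgue_measure_itv /= lte_fin expR_gt0
    -EFinB subr0.
  rewrite -EFinM expr0 mul1r -mulrA -expRD; congr (_ * expR _)%:E; lra.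
- move=> u /=; rewrite in_itv /= andbT => /negP u0.
  rewrite (_ : [set _ | _] = set0) ?integral_set0 //.
  by apply/seteqP; split => y //= [[/= h]]; rewrite h in u0.
Qed.

Lemma half_monomial_integrable i j :
  mu2.-integrable half_region (EFin \o half_monomial i j).
Proof.
apply/integrableP; split.
  by apply/measurable_EFinP/measurable_funTS; exact: measurable_half_monomial.
rewrite (eq_integral (fun z => (half_monomial i j z)%:E));
  first exact: half_moment_lty.
by move=> z; rewrite inE => Oz /=; rewrite ger0_norm // half_monomial_ge0.
Qed.

Definition half_Rmoment i j : R :=
  (\int[mu2]_(z in half_region) half_monomial i j z).

(** The two halves of the region contribute the two moments. *)
Lemma half_Rmoment_mzv i j : half_Rmoment i j + half_Rmoment j i =
  i`!%:R * j`!%:R * mzv (i.+2 :: nseq j 1%N).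
Proof.
rewrite -moment_mzv momentE fineD //.
  rewrite ge0_fin_numE ?half_moment_lty //; apply: integral_ge0 => z Oz.
  by rewrite lee_fin half_monomial_ge0.
rewrite ge0_fin_numE ?half_moment_lty //; apply: integral_ge0 => z Oz.
by rewrite lee_fin half_monomial_ge0.
Qed.

End Gamma.

(** * The kernel on half of the region, and the curve *)

Section Curve.
Context {R : realType}.
Implicit Types (a c d u x y r h : R).
Notation mu := (@lebesgue_measure R).
Notation plane := (measurableTypeR R * measurableTypeR R)%type.
Notation mu2 := (mu \x mu)%E.

(** The kernel at (h a, h b) in the coordinates (u, a). *)
Definition half_kernel h (z : plane) : R :=
  ray_kernel kernel_poly z.2 (z.1 + z.2) h.

Lemma half_kernelE h u a : half_kernel h (u, a) =
  logistic (h * u) ^+ 2 * (1 - logistic (h * u)) * expR (h * a).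
Proof.
by rewrite /half_kernel /ray_kernel /= addrK /kernel_poly hornerM hornerXn
  hornerD hornerN hornerX hornerC mulrC.
Qed.

Lemma continuous_logistic : continuous (@logistic R).
Proof. exact: is_derive_continuous. Qed.

Lemma measurable_half_kernel h : measurable_fun setT (half_kernel h).
Proof.
have -> : half_kernel h = fun z : plane =>
  logistic (h * z.1) ^+ 2 * (1 - logistic (h * z.1)) * expR (h * z.2).
  by apply/funext => -[u a]; rewrite half_kernelE.
have ms : measurable_fun setT (fun z : plane => logistic (h * z.1)).
  apply: measurableT_comp;
    first exact: (continuous_measurable_fun continuous_logistic).
  exact: measurable_funM.
apply: measurable_funM; first apply: measurable_funM.
- exact: measurable_funX.
- exact: measurable_funB.
- apply: measurableT_comp; first exact: measurable_expR.
  exact: measurable_funM.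
Qed.

Lemma half_kernel_ge0 h z : 0 <= half_kernel h z.
Proof.
case: z => u a; rewrite half_kernelE.
have s0 := logistic_gt0 (h * u); have s1 := logistic_lt1 (h * u).
by rewrite !mulr_ge0 ?expR_ge0 ?exprn_ge0 ?subr_ge0 ?(ltW s0) ?(ltW s1).
Qed.

Lemma softplusN_gt0 u : 0 < softplusN u.
Proof. by rewrite ln_gt0 // ltrDl expR_gt0. Qed.

(** In these coordinates a occurs only through e^(h a). *)
Lemma half_kernel_xintegral h : 0 < h ->
  (\int[mu2]_(z in half_region) (half_kernel h z)%:E =
   \int[mu]_(u in `[0%R, +oo[)
     (logistic (h * u) ^+ 2 * (1 - logistic (h * u)) *
       ((expR (h * softplusN u) - 1) / h))%:E)%E.
Proof.
move=> h0; rewrite tonelli_xsection; last 3 first.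
- exact: measurable_half_region.
- exact: measurable_half_kernel.
- by move=> z _; exact: half_kernel_ge0.
apply: integral_vanish_outside => u /=; last first.
  rewrite in_itv /= andbT => /negP u0.
  rewrite (_ : [set _ | _] = set0) ?integral_set0 //.
  by apply/seteqP; split => y //= [[/= h' _] _]; rewrite h' in u0.
rewrite in_itv /= andbT => u0.
  rewrite half_region_xsection //.
  under eq_integral do rewrite half_kernelE.
  set k := logistic _ ^+ 2 * _.
  pose F a : R := k / h * expR (h * a).
  have dF a : is_derive a 1 F (k * expR (h * a)).
    rewrite /F; apply: is_derive_eq; rewrite /GRing.scale /=.
    by field; rewrite gt_eqF.
  have cf : continuous (fun a => k * expR (h * a)).
    move=> a; apply: cvgM; first exact: cvg_cst.
    apply: continuous_comp; last exact: continuous_expR.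
    by apply: cvgM; [exact: cvg_cst|exact: cvg_id].
  rewrite integral_itv_obnd_cbnd; last first.
    apply/measurable_EFinP; apply: measurable_funTS.
    exact: continuous_measurable_fun.
  rewrite (FTC_smooth _ dF) //; last exact: ltW (softplusN_gt0 _).
by rewrite /F mulr0 expR0; congr EFin; ring.
Qed.

Definition curve (n : nat) x : R := (x ^+ n + (1 - x) ^+ n) `^ n%:R^-1.

Lemma powR_root n x : (0 < n)%N -> 0 <= x -> (x ^+ n) `^ n%:R^-1 = x.
Proof.
move=> n0 x0; rewrite -powR_mulrn // -powRrM divff ?powRr1 //.
by rewrite pnatr_eq0 -lt0n.
Qed.

(** For x = s(u / n) the ratio (1 - x) / x is e^(-u/n), so its n-th power
    does not depend on n: this is the reason for the substitution. *)
Lemma curve_logistic n u : (0 < n)%N ->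
  curve n (logistic (n%:R^-1 * u)) =
  logistic (n%:R^-1 * u) * expR (n%:R^-1 * softplusN u).
Proof.
move=> n0; set s := logistic _; have s0 : 0 < s := logistic_gt0 _.
have e : 1 - s = s * expR (- (n%:R^-1 * u)).
  have : 1 + expR (- (n%:R^-1 * u)) != 0 by rewrite gt_eqF // addr_gt0
    ?expR_gt0.
  by rewrite /s /logistic; move: (expR _) => v v0; field.
rewrite /curve e exprMn -expRM_natl mulrN mulrA divff ?pnatr_eq0 -?lt0n //
  mul1r.
rewrite -[X in X + _]mulr1 -mulrDr powRM;
  [|by rewrite exprn_ge0 ?(ltW s0)|by rewrite addr_ge0 ?expR_ge0].
rewrite powR_root ?(ltW s0) //; congr (_ * _).
rewrite /softplusN mulrC expRM lnK // posrE addr_gt0 ?expR_gt0 //.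
Qed.

Lemma curve_sym n x : curve n (1 - x) = curve n x.
Proof. by rewrite /curve subKr addrC. Qed.

Lemma curve_ge n x : (0 < n)%N -> 0 <= x <= 1 -> x <= curve n x.
Proof.
move=> n0 /andP[x0 x1]; rewrite -[leLHS](powR_root n0 x0) /curve.
by apply: ge0_ler_powR;
  rewrite ?invr_ge0 ?nnegrE ?addr_ge0 ?exprn_ge0 ?subr_ge0 // lerDl exprn_ge0
  ?subr_ge0.
Qed.

Lemma measurable_curve n : measurable_fun setT (curve n).
Proof.
apply: (measurableT_comp (measurable_powR _)).
by apply: measurable_funD; apply: measurable_funX => //; exact: measurable_funB.
Qed.

Lemma curve_continuous n x : 0 <= x <= 1 -> {for x, continuous (curve n)}.
Proof.
move=> /andP[x0 x1].
have p0 : 0 < x ^+ n + (1 - x) ^+ n.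
  have [/eqP ->|xn0] := boolP (x == 0).
    by rewrite subr0 expr1n ltr_pwDr // exprn_ge0.
  by rewrite ltr_pwDl ?exprn_ge0 ?subr_ge0 // exprn_gt0 // lt_neqAle eq_sym xn0.
apply: (@continuous_comp _ _ _ (fun x => x ^+ n + (1 - x) ^+ n) (fun y =>
  y `^ n%:R^-1)).
  apply: cvgD; first exact: exprn_continuous.
  apply: (@continuous_comp _ _ _ (fun x => 1 - x) (fun y => y ^+ n));
    last exact: exprn_continuous.
  by apply: cvgB; [exact: cvg_cst|exact: cvg_id].
apply/differentiable_continuous/derivable1_diffP.
by apply: derivable_powR; rewrite in_itv /= p0.
Qed.

End Curve.

(** * The integral I(n) as an integral over half of the region *)

Section Subst.
Context {R : realType}.
Implicit Types (a c d u x y r h l : R).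
Notation mu := (@lebesgue_measure R).
Notation plane := (measurableTypeR R * measurableTypeR R)%type.
Notation mu2 := (mu \x mu)%E.

(** Change of variables on a half-line whose image is bounded, as the limit
    of the change of variables on compact intervals. *)
Lemma integral_subst_halfline (F f G : R -> R) l :
  (forall x, is_derive x 1 F (f x)) -> continuous f -> (forall x, 0 < f x) ->
  (fun k : nat => F k%:R) @ \oo --> l ->
  measurable_fun setT G ->
  (forall x, F 0 <= x <= l -> {for x, continuous G}) ->
  (forall x, F 0 <= x <= l -> 0 <= G x) ->
  (\int[mu]_(x in `[F 0%R, l]) (G x)%:E =
   \int[mu]_(x in `[0%R, +oo[) (G (F x) * f x)%:E)%E.
Proof.
move=> dF cf f0 Fl mG cG G0.
have cF := is_derive_continuous dF.
have Finc x y : x < y -> F x < F y.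
  move=> xy; have [|z _ E] := MVT xy (fun z _ => dF z).
    exact: continuous_subspaceT.
  by rewrite -subr_gt0 E mulr_gt0 // subr_gt0.
have Fle x y : x <= y -> F x <= F y.
  by rewrite le_eqVlt => /predU1P[-> //|/Finc/ltW].
have Fkl (k : nat) : F k%:R <= l.
  rewrite -(cvg_lim _ Fl) //; apply: nondecreasing_cvgn_le.
    by move=> m n mn; apply: Fle; rewrite ler_nat.
  by apply/cvg_ex; exists l.
have fE : F^`()%classic = f by apply/funext => x; rewrite derive1E;
  case: (dF x).
have step (k : nat) : (\int[mu]_(x in `[F 0%R, F k%:R]) (G x)%:E =
   \int[mu]_(x in `[0%R, k%:R]) (G (F x) * f x)%:E)%E.
  rewrite (@integration_by_substitution_increasing R F G 0 k%:R) ?fE //.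
  - by move=> x y _ _; exact: Finc.
  - by apply/cvg_ex; exists (f 0); apply: cvg_at_right_filter; exact: cf.
  - by apply/cvg_ex; exists (f k%:R); apply: cvg_at_left_filter; exact: cf.
  - split; first by move=> x _; case: (dF x).
    + by apply: cvg_at_right_filter; exact: cF.
    + by apply: cvg_at_left_filter; exact: cF.
  - apply: continuous_in_subspaceT => x; rewrite inE /= in_itv /= =>
    /andP[x0 xk].
    by apply: cG; rewrite x0 (le_trans xk).
rewrite -integral_itv_bndo_bndc; last by apply/measurable_EFinP;
  exact: measurable_funTS.
have U1 : \bigcup_(k : nat) `[F 0, F k%:R]%classic = `[F 0, l[%classic.
  apply/seteqP; split => x /=.
    move=> [k _] /=; rewrite !in_itv /= => /andP[-> xk] /=.
    apply: le_lt_trans xk _; apply: lt_le_trans (Fkl k.+1); apply: Finc.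
    by rewrite ltr_nat.
  rewrite in_itv /= => /andP[x0 xl].
  have /cvgr_gt /(_ _ xl) [k _ kP] := Fl.
  exists k => //=; rewrite in_itv /= x0 ltW //; exact: kP k (leqnn k).
have U2 : \bigcup_(k : nat) `[(0:R), k%:R]%classic = `[(0:R), +oo[%classic.
  apply/seteqP; split => x /=.
    by move=> [k _] /=; rewrite !in_itv /= => /andP[-> _].
  rewrite in_itv /= andbT => x0.
  exists (Num.truncn x).+1 => //=; rewrite in_itv /= x0 /= ltW //.
  by rewrite truncnS_gt.
have mGF : measurable_fun setT (fun x => G (F x) * f x).
  apply: measurable_funM; last exact: continuous_measurable_fun.
  by apply: measurableT_comp => //; exact: continuous_measurable_fun.
have L1 : (fun k : nat => (\int[mu]_(x in `[F 0%R, F k%:R]) (G x)%:E)%E) @ \oo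
  -->
    (\int[mu]_(x in `[F 0%R, l[) (G x)%:E)%E.
  rewrite -U1; apply: ge0_nondecreasing_set_cvg_integral => //.
  - move=> m n mn; apply/subsetPset => x /=; rewrite !in_itv /= =>
    /andP[-> /le_trans]; apply.
    by apply: Fle; rewrite ler_nat.
  - by move=> k; apply/measurable_EFinP; exact: measurable_funTS.
  - move=> k x /=; rewrite in_itv /= => /andP[x0 xk].
    by rewrite lee_fin G0 // x0 (le_trans xk).
have L2 : (fun k : nat => (\int[mu]_(x in `[F 0%R, F k%:R]) (G x)%:E)%E) @ \oo
  -->
    (\int[mu]_(x in `[0%R, +oo[) (G (F x) * f x)%:E)%E.
  rewrite (funext step) -U2; apply: ge0_nondecreasing_set_cvg_integral => //.
  - move=> m n mn; apply/subsetPset => x /=; rewrite !in_itv /= =>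
    /andP[-> /le_trans]; apply.
    by rewrite ler_nat.
  - by move=> k; apply/measurable_EFinP; exact: measurable_funTS.
  - move=> k x /=; rewrite in_itv /= => /andP[x0 xk].
    rewrite lee_fin mulr_ge0 ?(ltW (f0 _)) // G0 // Fle //=.
    by apply: le_trans (Fkl k); exact: Fle.
exact: cvg_unique L1 L2.
Qed.

Lemma logistic_cvg1 h : 0 < h ->
  (fun k : nat => logistic (h * k%:R)) @ \oo --> (1 : R).
Proof.
move=> h0.
have -> : (fun k : nat => logistic (h * k%:R)) = (fun k : nat =>
  (1 + (expR (- h)) ^+ k)^-1).
  by apply/funext => k; rewrite /logistic -mulNr expRM_natr.
rewrite -[X in _ --> X]invr1; apply: cvgV; first exact: oner_neq0.
rewrite -[X in _ --> X]addr0; apply: cvgD; first exact: cvg_cst.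
apply: cvg_expr; rewrite ger0_norm ?expR_ge0 // expR_lt1 oppr_lt0 //.
Qed.

(** The substitution x = s(h u) contributes a factor h and the integral of the
    kernel in a a factor 1 / h; apart from these, both sides are the same
    integral over u. *)
Lemma half_curve_integral n : (0 < n)%N ->
  (\int[mu]_(x in `[(2^-1)%R, 1%R]) (curve n x - x)%:E =
   ((n%:R^-1) ^+ 2)%:E *
   \int[mu2]_(z in half_region) (half_kernel n%:R^-1 z)%:E)%E.
Proof.
move=> n0; set h : R := n%:R^-1.
have h0 : 0 < h by rewrite invr_gt0 ltr0n.
pose F u := logistic (h * u); pose f u :=
  h * (logistic (h * u) * (1 - logistic (h * u))).
have dF x : is_derive x 1 F (f x).
  rewrite /F /f; apply: is_derive_eq; rewrite /GRing.scale /=; ring.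
have F0 : F 0 = 2^-1 by rewrite /F mulr0 logistic0.
have s1 x : 0 < 1 - logistic x :> R by rewrite subr_gt0 logistic_lt1.
have cs : continuous (fun x =>
  logistic (h * x)) by exact: (is_derive_continuous dF).
have cf : continuous f.
  move=> x; apply: cvgM; first exact: cvg_cst.
  apply: cvgM; first exact: cs.
  by apply: cvgB; [exact: cvg_cst|exact: cs].
rewrite -F0 (@integral_subst_halfline F f (fun x => curve n x - x) 1) //;
  last first.
- move=> x; rewrite F0 => /andP[x0 x1]; rewrite subr_ge0 curve_ge // x1 andbT.
  by apply: le_trans x0; rewrite invr_ge0.
- move=> x; rewrite F0 => /andP[x0 x1]; apply: cvgB; last exact: cvg_id.
  by apply: curve_continuous; rewrite x1 andbT; apply: le_trans x0;
    rewrite invr_ge0.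
- by apply: measurable_funB => //; exact: measurable_curve.
- exact: logistic_cvg1.
- by move=> x; rewrite !mulr_gt0 ?logistic_gt0.
rewrite half_kernel_xintegral // -ge0_integralZl_EFin //; last 3 first.
- move=> u _; rewrite lee_fin !mulr_ge0 ?exprn_ge0 ?invr_ge0 ?(ltW h0)
  ?(ltW (s1 _)) ?(ltW (logistic_gt0 _)) //.
  by rewrite subr_ge0 -expR0 ler_expR mulr_ge0 ?(ltW h0)
    ?(ltW (softplusN_gt0 _)).
- apply/measurable_EFinP; apply: measurable_funTS.
  apply: measurable_funM.
    apply: measurable_funM; first by apply: measurable_funX;
      exact: continuous_measurable_fun.
    by apply: measurable_funB => //; exact: continuous_measurable_fun.
  apply: measurable_funM => //; apply: measurable_funB => //.
  apply: measurableT_comp; first exact: measurable_expR.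
  apply: measurable_funM => //; apply: measurableT_comp;
    first exact: measurable_ln.
  apply: measurable_funD => //; apply: measurableT_comp;
    first exact: measurable_expR.
  exact: measurable_funN.
- by rewrite exprn_ge0 // ltW.
apply: eq_integral => u _; rewrite -EFinM; congr EFin.
rewrite /F /f curve_logistic // -/h.
have hn : h != 0 by rewrite gt_eqF.
by move: (h) hn (logistic _) (expR _) => v v0 s e; field.
Qed.

(** The Taylor bound of order 0 says that the kernel is bounded, and the half
    region has finite area. *)
Lemma half_kernel_integrable h : 0 <= h <= 1 ->
  mu2.-integrable half_region (EFin \o half_kernel h).
Proof.
move=> h01.
have [C C0 CP] := ray_kernel_taylor (R := R) 0.
apply: (@le_integrable _ _ _ mu2 half_region _ _ (fun z =>
  C%:E * (half_monomial 0 0 z)%:E)%E).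
- exact: measurable_half_region.
- by apply/measurable_EFinP/measurable_funTS; exact: measurable_half_kernel.
- move=> z Oz /=; have [[z1 z2] _] := Oz; have [_ z2'] := half_region_sub Oz.
  rewrite lee_fin /half_monomial !expr0 !mulr1 [leRHS]ger0_norm //.
  have := CP z.2 (z.1 + z.2) h; rewrite big_ord0 subr0 !expr0 !mulr1; apply =>
    //.
    by rewrite ltW //= lerDr.
  by apply: le_trans z2' _; rewrite expR_le1 oppr_le0.
- by apply: integrableZl;
  [exact: measurable_half_region|exact: half_monomial_integrable].
Qed.

(** The symmetry x |-> 1 - x reduces to the interval [1/2, 1], where x is
    split off the integrand; its integral, 3/8, is doubled. *)
Lemma curveI_half_kernel n : (0 < n)%N ->
  curveI n = 3 / 4 + 2 * n%:R^-1 ^+ 2 *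
    (\int[mu2]_(z in half_region) half_kernel n%:R^-1 z)%R.
Proof.
move=> n0.
have -> : curveI n = fine (\int[mu]_(x in `[0%R, 1%R]) (curve n x)%:E)%E.
  by rewrite /curveI; congr fine; apply: eq_integral => x _.
have h01 : 0 <= (n%:R^-1 : R) <= 1.
  by rewrite invr_ge0 ler0n invf_le1 ?ltr0n // ler1n.
have mr := measurable_curve (R := R) n.
have c1 : {within `[(0:R), 2^-1], continuous (curve n)}.
  apply: continuous_in_subspaceT => x; rewrite inE /= in_itv /= => /andP[x0 x1].
  by apply: curve_continuous; rewrite x0 /=; lra.
have r0 x : 0 <= curve n x by exact: powR_ge0.
have E1 : (\int[mu]_(x in `[0%R, 2^-1%R]) (curve n x)%:E =
   \int[mu]_(x in `[2^-1%R, 1%R]) (curve n x)%:E)%E.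
  have h2 : 0 <= (2^-1 : R) <= 1 by lra.
  Timeout 20 rewrite (integration_by_substitution_onem h2 c1).
  rewrite /unstable.onem (_ : 1 - 2^-1 = 2^-1 :> R); last by lra.
  by apply: eq_integral => x _; rewrite curve_sym.
have E2 : (\int[mu]_(x in `[0%R, 1%R]) (curve n x)%:E =
   \int[mu]_(x in `[0%R, 2^-1%R]) (curve n x)%:E +
     \int[mu]_(x in `[2^-1%R, 1%R]) (curve n x)%:E)%E.
  rewrite -[in X in (_ + X)%E]integral_itv_obnd_cbnd; last first.
    by apply/measurable_EFinP; exact: measurable_funTS.
  rewrite -ge0_integral_setU //=.
  - by rewrite -itv_bndbnd_setU // bnd_simp; lra.
  - by apply/measurable_EFinP; exact: measurable_funTS.
  - by move=> x _; rewrite lee_fin.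
  - apply/disj_setPS => x [] /=; rewrite !in_itv /= => /andP[_ h] /andP[h' _].
    by have := lt_le_trans h' h; rewrite ltxx.
have E3 : (\int[mu]_(x in `[2^-1%R, 1%R]) (curve n x)%:E =
   \int[mu]_(x in `[2^-1%R, 1%R]) (curve n x - x)%:E + (3 / 8 : R)%:E)%E.
  have <- : (\int[mu]_(x in `[2^-1%R, 1%R]) x%:E = (3 / 8 : R)%:E)%E.
    under eq_integral do rewrite -[X in X%:E]mul1r -[X in _ * X]expr1
      -[X in X ^+ 1]addr0.
    rewrite integral_pow_itv; last by lra.
    by congr EFin; lra.
  rewrite -ge0_integralD //.
  - by apply: eq_integral => x _; rewrite -EFinD subrK.
  - move=> x /=; rewrite in_itv /= => /andP[x0 x1];
    rewrite lee_fin subr_ge0 curve_ge //; lra.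
  - by apply/measurable_EFinP; apply: measurable_funTS; apply: measurable_funB.
  - move=> x /=; rewrite in_itv /= => /andP[x0 x1]; rewrite lee_fin; lra.
have J : (\int[mu2]_(z in half_region) (half_kernel n%:R^-1 z)%:E)%E =
    (\int[mu2]_(z in half_region) half_kernel n%:R^-1 z)%R%:E.
  rewrite /Rintegral fineK //; apply: integrable_fin_num;
    first exact: measurable_half_region.
  exact: half_kernel_integrable.
rewrite E2 E1 E3 half_curve_integral // J -EFinM -!EFinD /=.
have aux (v w : R) : v * w + 3 / 8 + (v * w + 3 / 8) = 3 / 4 + 2 * v *
  w by field.
exact: aux.
Qed.

End Subst.

(** * The asymptotic series and its coefficients *)

Section Asymp.
Context {R : realType}.
Implicit Types (a c d u x y r h l : R).
Notation mu := (@lebesgue_measure R).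
Notation plane := (measurableTypeR R * measurableTypeR R)%type.
Notation mu2 := (mu \x mu)%E.

Lemma Rintegral_lincomb n (k : nat -> R) (f : nat -> plane -> R) :
  (forall i, mu2.-integrable half_region (EFin \o f i)) ->
  mu2.-integrable half_region (EFin \o (fun z => \sum_(i < n) k i * f i z)) /\
  (\int[mu2]_(z in half_region) (\sum_(i < n) k i * f i z))%R =
  \sum_(i < n) k i * (\int[mu2]_(z in half_region) f i z)%R.
Proof.
move=> If; have mO := @measurable_half_region R.
have Ik i : mu2.-integrable half_region (EFin \o (fun z => k i * f i z)).
  exact: (integrableZl mO (k i) (If i)).
elim: n => [|n [IH1 IH2]].
  split.
    rewrite (_ : _ \o _ = cst 0%E); first exact: integrable0.
    by apply/funext => z /=; rewrite big_ord0.
  under eq_Rintegral do rewrite big_ord0.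
  by rewrite big_ord0 /Rintegral integral0.
have E : (fun z => \sum_(i < n.+1) k i * f i z) =
    (fun z => \sum_(i < n) k i * f i z + k n * f n z).
  by apply/funext => z; rewrite big_ord_recr.
split.
  rewrite E; exact: (integrableD mO IH1 (Ik n)).
by rewrite E RintegralD // big_ord_recr /= IH2 RintegralZl.
Qed.

Definition half_ray_coef i (z : plane) : R := ray_coef i z.2 (z.1 + z.2).

Lemma half_ray_coefE N z : half_ray_coef N z =
  \sum_(j < N.+1) ('C(N, j)%:R * mixed_coef N j) * half_monomial j (N - j) z.
Proof.
rewrite /half_ray_coef ray_coef_expand; apply: eq_bigr => j _.
by rewrite /half_monomial /mixed_coef; ring.
Qed.

(** The same expansion after the exchange of a and b.  Adding both versions
    reassembles the moments of the two halves of the region. *)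
Lemma half_ray_coef_swapE N z : half_ray_coef N z =
  \sum_(j < N.+1) ('C(N, j)%:R * mixed_coef N j) * half_monomial (N - j) j z.
Proof.
rewrite /half_ray_coef ray_coefC ray_coef_expand; apply: eq_bigr => j _.
by rewrite /half_monomial /mixed_coef; ring.
Qed.

Lemma half_ray_coef_integrable N :
  mu2.-integrable half_region (EFin \o half_ray_coef N).
Proof.
rewrite (_ : half_ray_coef N = fun z =>
  \sum_(j < N.+1) ('C(N, j)%:R * mixed_coef N j) * half_monomial j (N - j) z).
  apply: (@Rintegral_lincomb N.+1 (fun j =>
    'C(N, j)%:R * mixed_coef N j) (fun j => half_monomial j (N - j)) _).1.
  by move=> i; exact: half_monomial_integrable.
by apply/funext => z; exact: half_ray_coefE.
Qed.

Definition half_coef N : R :=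
  (\int[mu2]_(z in half_region) half_ray_coef N z)%R.

Lemma half_coefE N : half_coef N *+ 2 / N`!%:R =
  \sum_(j < N.+1) mixed_coef N j * mzv (j.+2 :: nseq (N - j) 1%N).
Proof.
have E1 : half_coef N = \sum_(j < N.+1) ('C(N, j)%:R * mixed_coef N j) *
  half_Rmoment j (N - j).
  rewrite -(@Rintegral_lincomb N.+1 (fun j => 'C(N, j)%:R * mixed_coef N j)
    (fun j => half_monomial j (N - j)) _).2.
    by apply: eq_Rintegral => z _; exact: half_ray_coefE.
  by move=> i; exact: half_monomial_integrable.
have E2 : half_coef N = \sum_(j < N.+1) ('C(N, j)%:R * mixed_coef N j) *
  half_Rmoment (N - j) j.
  rewrite -(@Rintegral_lincomb N.+1 (fun j => 'C(N, j)%:R * mixed_coef N j)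
    (fun j => half_monomial (N - j) j) _).2.
    by apply: eq_Rintegral => z _; exact: half_ray_coef_swapE.
  by move=> i; exact: half_monomial_integrable.
rewrite mulr2n {1}E1 E2 -big_split /= mulr_suml; apply: eq_bigr => j _.
rewrite -mulrDr half_Rmoment_mzv.
have <- : 'C(N, j)%:R * (j`!%:R * (N - j)`!%:R) = N`!%:R :> R.
  by rewrite -!natrM bin_fact // -ltnS.
have : j`!%:R != 0 :> R by rewrite pnatr_eq0 -lt0n fact_gt0.
have : (N - j)`!%:R != 0 :> R by rewrite pnatr_eq0 -lt0n fact_gt0.
have : 'C(N, j)%:R != 0 :> R by rewrite pnatr_eq0 -lt0n bin_gt0 -ltnS.
move: (j`!%:R : R) ((N - j)`!%:R : R) ('C(N, j)%:R : R) (mixed_coef N j)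
  (mzv _) => v w b U Z b0 w0 v0.
by field; rewrite v0 w0 b0.
Qed.

Lemma half_kernel_expansion N : exists2 C, 0 <= C & forall h, 0 <= h <= 1 ->
  `|(\int[mu2]_(z in half_region) half_kernel h z)%R -
    \sum_(i < N) half_coef i / i`!%:R * h ^+ i| <= C * h ^+ N.
Proof.
have [C C0 CP] := ray_kernel_taylor (R := R) N.
have mO := @measurable_half_region R.
exists (C * half_Rmoment 0 N) => [|h h01].
  by rewrite mulr_ge0 // Rintegral_ge0 // => z; exact: half_monomial_ge0.
have [I1 I2] := @Rintegral_lincomb N (fun i => h ^+ i / i`!%:R) half_ray_coef
  half_ray_coef_integrable.
have -> : \sum_(i < N) half_coef i / i`!%:R * h ^+ i =
    (\int[mu2]_(z in half_region) \sum_(i < N) h ^+ i / i`!%:R *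
      half_ray_coef i z)%R.
  by rewrite I2; apply: eq_bigr => i _; rewrite mulrC mulrAC mulrA.
have Ik := half_kernel_integrable h01.
rewrite -RintegralB //.
apply: le_trans (le_normr_Rintegral mO _) _.
  exact: (integrableB mO Ik I1).
have -> : C * half_Rmoment 0 N * h ^+ N =
  (\int[mu2]_(z in half_region) (C * h ^+ N * half_monomial 0 N z))%R.
  by rewrite RintegralZl //; [rewrite mulrAC|exact: half_monomial_integrable].
apply: le_Rintegral => //.
- exact: (integrable_norm (integrableB mO Ik I1)).
- exact: (integrableZl mO _ (half_monomial_integrable 0 N)).
move=> z Oz; have [[z1 z2] _] := Oz; have [_ z2'] := half_region_sub Oz.
rewrite /half_monomial expr0 mul1r mulrAC.
have -> : \sum_(i < N) h ^+ i / i`!%:R * half_ray_coef i z =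
    \sum_(i < N) ray_coef i z.2 (z.1 + z.2) * h ^+ i / i`!%:R.
  by apply: eq_bigr => i _; rewrite mulrC mulrA.
apply: CP => //; first by rewrite ltW //= lerDr.
by apply: le_trans z2' _; rewrite expR_le1 oppr_le0.
Qed.

(** The factor 2 accounts for the half of the region that was left out. *)
Definition curve_coef (p : nat) : R :=
  match p with 0 => 3 / 4 | 1 => 0 | q.+2 => half_coef q *+ 2 / q`!%:R end.

Lemma curveI_expansion N : exists C, forall n, (0 < n)%N ->
  `|curveI n - \sum_(0 <= j < N.+3) curve_coef j / n%:R ^+ j|
  <= C * n%:R^-1 ^+ N.+3.
Proof.
have [C C0 CP] := half_kernel_expansion N.+1.
exists (2 * C) => n n0; rewrite curveI_half_kernel //.
set h : R := n%:R^-1.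
have h01 : 0 <= h <= 1 by rewrite invr_ge0 ler0n invf_le1 ?ltr0n // ler1n.
have {CP} := CP h h01; set J := Rintegral _ _ _; set S := \sum_(i < _) _ => CP.
rewrite big_nat_recl // big_nat_recl // big_mkord.
have -> : \sum_(i < N.+1) curve_coef i.+2 / n%:R ^+ i.+2 = 2 * h ^+ 2 * S.
  rewrite /S mulr_sumr; apply: eq_bigr => i _.
  by rewrite -exprVn -/h /= !exprS -mulr_natl; ring.
rewrite /= expr0 divr1 mul0r add0r opprD addrACA subrr add0r -mulrBr normrM.
have h2 : 0 <= 2 * h ^+ 2 by rewrite mulr_ge0 // sqr_ge0.
have -> : 2 * C * h ^+ N.+3 = 2 * h ^+ 2 * (C * h ^+ N.+1) by rewrite !exprS;
  ring.
by rewrite (ger0_norm h2) ler_wpM2l.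
Qed.

(** The constant term is O(1/n), hence 0; dividing by 1/n lowers the
    order. *)
Lemma inv_poly_bigO_eq0 K (d : nat -> R) C n0 :
  (forall n, (n0 <= n)%N -> (0 < n)%N ->
     `|\sum_(j < K) d j * n%:R^-1 ^+ j| <= C * n%:R^-1 ^+ K) ->
  forall j, (j < K)%N -> d j = 0.
Proof.
elim: K d => [|K IH] d H j //.
have d0 : d 0 = 0.
  apply/eqP/negPn/negP => dn0.
  (* |d 0| <= B / n for large n, so n > B / |d 0| is a contradiction *)
  pose B := `|C| + \sum_(j < K) `|d j.+1|.
  have B0 : 0 <= B by rewrite addr_ge0 ?sumr_ge0.
  pose n := maxn n0 (Num.truncn (B / `|d 0|)).+1.
  have n1 : (0 < n)%N by rewrite leq_max orbT.
  have h0 : 0 < n%:R^-1 :> R by rewrite invr_gt0 ltr0n.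
  have h1 : n%:R^-1 <= 1 :> R by rewrite invf_le1 ?ltr0n // ler1n.
  have hk k : n%:R^-1 ^+ k <= 1 :> R by rewrite exprn_ile1 // ltW.
  have hk0 k : 0 <= n%:R^-1 ^+ k :> R by rewrite exprn_ge0 // ltW.
  have : `|d 0| <= B * n%:R^-1.
    have := H n (leq_maxl _ _) n1; rewrite big_ord_recl expr0 mulr1.
    set S := \sum_(i < K) _ => HS.
    have -> : d 0 = (d 0 + S) - S by rewrite addrK.
    apply: le_trans (ler_normB _ _) _; rewrite /B mulrDl; apply: lerD.
      apply: le_trans HS _; rewrite exprS mulrA.
      apply: le_trans (_ : `|C| * n%:R^-1 * n%:R^-1 ^+ K <= _).
        by rewrite ler_wpM2r // ler_wpM2r ?(ltW h0) // ler_norm.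
      by rewrite ler_piMr // mulr_ge0 // ltW.
    rewrite mulr_suml; apply: le_trans (ler_norm_sum _ _ _) _.
    apply: ler_sum => i _; rewrite normrM ler_wpM2l // ger0_norm //.
    by rewrite /= exprS ler_piMr // ltW.
  rewrite ler_pdivlMr ?ltr0n // mulrC -ler_pdivlMr ?normr_gt0 //.
  apply/negP; rewrite -ltNge; apply: lt_le_trans (truncnS_gt _) _.
  by rewrite ler_nat leq_max leqnn orbT.
case: j => [//|j] jK; apply: (IH (fun j => d j.+1)) => // n nn0 n1.
have := H n nn0 n1; rewrite big_ord_recl d0 mul0r add0r.
have h0 : 0 < n%:R^-1 :> R by rewrite invr_gt0 ltr0n.
under eq_bigr do rewrite /= exprS mulrCA.
rewrite -mulr_sumr normrM (ger0_norm (ltW h0)) exprS mulrCA.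
by rewrite ler_pM2l.
Qed.

End Asymp.

(** Both series approximate the same function to order q + 3. *)
Lemma asymptotic_series_coefE (R : realType) (c : nat -> R)
    (hc : asymptotic_series curveI c) q :
  c q.+2 = curve_coef q.+2.
Proof.
have /eqOP /pinfty_ex_gt0 [k k0 [n0 _ kP]] := hc q.+2.
have [C CP] := curveI_expansion (R := R) q.
apply/eqP; rewrite -subr_eq0; apply/eqP.
pose d j : R := c j - curve_coef j.
apply: (@inv_poly_bigO_eq0 R q.+3 d (k + C) n0 _ q.+2 (leqnn _)) => n nn0 n1.
have := kP n nn0; have := CP n n1; rewrite /=.
rewrite !big_mkord; set S1 := \sum_(i < q.+3) _; set S2 := \sum_(i < q.+3) _ =>
  h1 h2.
have -> : \sum_(j < q.+3) d j * n%:R^-1 ^+ j = (curveI n - S1) -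
  (curveI n - S2).
  transitivity (S2 - S1); last by ring.
  rewrite -sumrB; apply: eq_bigr => j _.
  by rewrite /d exprVn mulrBl.
rewrite mulrDl [leRHS]addrC; apply: (le_trans (ler_normB _ _)); apply: lerD =>
  //.
by apply: (le_trans h2); rewrite -exprVn ger0_norm // exprn_ge0 ?invr_ge0.
Qed.

Theorem theorem2 (R : realType) (c : nat -> R)
    (hc : asymptotic_series curveI c) (p : nat) (hp : (2 <= p)%N) :
  c p = (-1) ^+ p / 2 *
    \sum_(1 <= k < p)
      (-1) ^+ k * mzv (k.+1 :: nseq (p - k - 1) 1%N) *
      \sum_(0 <= j < k) 'C(k.-1, j)%:R * euler_a (p - 1 - j)./2.
Proof.
case: p hp => [|[|q]] // _.
rewrite (asymptotic_series_coefE hc) /= half_coefE.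
rewrite big_add1 /= big_mkord mulr_sumr.
apply: eq_bigr => k _.
have kq : (k <= q)%N by rewrite -ltnS.
rewrite mixed_coefE // big_mkord.
have -> : (q.+2 - k.+1 - 1 = q - k)%N by rewrite subSS subn1 subSn.
have -> : \sum_(l < k.+1) 'C(k, l)%:R * euler_a (q - l).+1./2 =
  \sum_(l < k.+1) 'C(k, l)%:R * euler_a (q.+2 - 1 - l)./2 :> R.
  apply: eq_bigr => l _; rewrite subn1 /= subSn //.
  by apply: leq_trans kq; rewrite -ltnS.
have -> : (-1) ^+ (q + k).+1 = (-1) ^+ q.+2 * (-1) ^+ k.+1 :> R.
  by rewrite -exprD addSn addnS addSn !exprS; ring.
ring.
Qed.
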